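(* Let $\Omega\subset\mathbb{R}^n$ be a bounded open set with smooth boundary, $\mu>0$, $2\mu+n\lambda\ge0$, $\kappa>0$, $\gamma>1$, $R>0$, $\rho_0\in C(\bar\Omega)$ with $\rho_0>0$ in $\Omega$, $\rho_0=0$ on $\partial\Omega$, and $u_0,e_0$ continuous with $e_0\ge0$, $e_0\not\equiv0$ in $\Omega$. Then for every $T>0$ the problem $$\partial_t\rho+\operatorname{div}(\rho u)=0,\qquad \partial_t(\rho u)+\operatorname{div}(\rho u\otimes u)+\nabla p=\mu\Delta u+(\mu+\lambda)\nabla\operatorname{div}u,$$ $$\partial_t(\rho e)+\operatorname{div}(\rho e u)+p\operatorname{div}u=\tfrac{\mu}{2}|\nabla u+(\nabla u)^T|^2+\lambda(\operatorname{div}u)^2+\tfrac{\kappa(\gamma-1)}{R}\Delta e\qquad\text{in }\Omega\times(0,T],$$ with $p=(\gamma-1)\rho e$, $(\rho,u,e)=(\rho_0,u_0,e_0)$ on $\Omega\times\{t=0\}$, and $e=\partial_{x_i}e=0$ ($i=1,\dots,n$) on $\partial\Omega\times(0,T]$, has no solution $(\rho,u,e)$ in $C^{2,1}(\bar\Omega\times[0,T])$.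
   Context: $C^{2,1}(\bar\Omega\times[0,T])$ denotes functions that are $C^2$ in $x$ and $C^1$ in $t$ on $\bar\Omega\times[0,T]$. *)

(* Defs.v *)
From Stdlib Require Import Reals Lra.
Open Scope R_scope.

(** Points of R^n are represented as [nat -> R]; a point lies in R^n when all
    coordinates of index >= n vanish. *)
Definition pt := nat -> R.

Definition inRn (n : nat) (x : pt) : Prop := forall j, (n <= j)%nat -> x j = 0.

Fixpoint sumR (n : nat) (f : nat -> R) : R :=
  match n with O => 0 | S m => sumR m f + f m end.

Definition distn (n : nat) (x y : pt) : R :=
  sqrt (sumR n (fun j => (x j - y j) ^ 2)).

Definition upd (x : pt) (i : nat) (s : R) : pt :=
  fun j => if Nat.eqb j i then s else x j.

Definition is_open (n : nat) (O : pt -> Prop) : Prop :=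
  forall x, O x -> inRn n x /\
    exists r, 0 < r /\ forall y, inRn n y -> distn n x y < r -> O y.

Definition is_bounded (n : nat) (O : pt -> Prop) : Prop :=
  exists M, forall x, O x -> distn n x (fun _ => 0) <= M.

Definition closure (n : nat) (O : pt -> Prop) (x : pt) : Prop :=
  inRn n x /\ forall r, 0 < r -> exists y, O y /\ distn n x y < r.

Definition boundary (n : nat) (O : pt -> Prop) (x : pt) : Prop :=
  closure n O x /\ ~ O x.

Definition pd (i : nat) (f : pt -> R) (x : pt) (l : R) : Prop :=
  derivable_pt_lim (fun s => f (upd x i s)) (x i) l.

Definition cont_Rn (n : nat) (f : pt -> R) (x : pt) : Prop :=
  forall eps, 0 < eps -> exists d, 0 < d /\
    forall y, inRn n y -> distn n x y < d -> Rabs (f y - f x) < eps.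

(** f is C^infinity on R^n: it belongs to a class of continuous functions
    closed under taking partial derivatives. *)
Definition smooth (n : nat) (f : pt -> R) : Prop :=
  exists S : (pt -> R) -> Prop, S f /\
    forall g, S g ->
      (forall x, inRn n x -> cont_Rn n g x) /\
      (forall i, (i < n)%nat -> exists dg, S dg /\
         forall x, inRn n x -> pd i g x (dg x)).

Definition smooth_boundary (n : nat) (O : pt -> Prop) : Prop :=
  exists phi, smooth n phi /\
    (forall x, inRn n x -> (O x <-> phi x < 0)) /\
    (forall x, boundary n O x ->
       exists i l, (i < n)%nat /\ pd i phi x l /\ l <> 0).

Definition cont_on_closure (n : nat) (O : pt -> Prop) (f : pt -> R) : Prop :=
  forall x, closure n O x -> forall eps, 0 < eps -> exists d, 0 < d /\
    forall y, closure n O y -> distn n x y < d -> Rabs (f y - f x) < eps.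

Definition inK (n : nat) (O : pt -> Prop) (T : R) (x : pt) (t : R) : Prop :=
  closure n O x /\ 0 <= t <= T.

Definition cont_on_K (n : nat) (O : pt -> Prop) (T : R) (F : pt -> R -> R) : Prop :=
  forall x t, inK n O T x t -> forall eps, 0 < eps -> exists d, 0 < d /\
    forall y s, inK n O T y s -> distn n x y < d -> Rabs (s - t) < d ->
      Rabs (F y s - F x t) < eps.

Definition DT (n : nat) (O : pt -> Prop) (T : R) (F G : pt -> R -> R) : Prop :=
  cont_on_K n O T G /\
  forall x t, O x -> 0 < t < T -> derivable_pt_lim (fun s => F x s) t (G x t).

Definition DX (n : nat) (O : pt -> Prop) (T : R) (i : nat) (F G : pt -> R -> R) : Prop :=
  cont_on_K n O T G /\
  forall x t, O x -> 0 < t < T -> pd i (fun y => F y t) x (G x t).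

Definition C21 (n : nat) (O : pt -> Prop) (T : R) (F : pt -> R -> R) : Prop :=
  cont_on_K n O T F /\
  (exists Ft, DT n O T F Ft) /\
  exists Fx : nat -> pt -> R -> R,
    forall i, (i < n)%nat -> DX n O T i F (Fx i) /\
      forall j, (j < n)%nat -> exists Fxx, DX n O T j (Fx i) Fxx.

Definition is_solution (n : nat) (O : pt -> Prop) (T mu lam kappa gam Rg : R)
  (rho0 : pt -> R) (u0 : nat -> pt -> R) (e0 : pt -> R)
  (rho : pt -> R -> R) (u : nat -> pt -> R -> R) (e : pt -> R -> R) : Prop :=
  let p := fun x t => (gam - 1) * rho x t * e x t in
  C21 n O T rho /\ (forall j, (j < n)%nat -> C21 n O T (u j)) /\ C21 n O T e /\
  (forall x, O x -> rho x 0 = rho0 x /\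
     (forall j, (j < n)%nat -> u j x 0 = u0 j x) /\ e x 0 = e0 x) /\
  exists (Rt : pt -> R -> R) (M : nat -> pt -> R -> R)
         (Mt : nat -> pt -> R -> R) (Q : nat -> nat -> pt -> R -> R)
         (Px : nat -> pt -> R -> R)
         (U1 U2 : nat -> nat -> pt -> R -> R) (V : nat -> pt -> R -> R)
         (Et : pt -> R -> R) (W : nat -> pt -> R -> R)
         (E1 E2 : nat -> pt -> R -> R),
    let divu := fun x t => sumR n (fun j => U1 j j x t) in
    DT n O T rho Rt /\
    (forall j, (j < n)%nat -> DX n O T j (fun x t => rho x t * u j x t) (M j)) /\
    (forall k, (k < n)%nat -> DT n O T (fun x t => rho x t * u k x t) (Mt k)) /\
    (forall j k, (j < n)%nat -> (k < n)%nat ->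
       DX n O T j (fun x t => rho x t * u j x t * u k x t) (Q j k)) /\
    (forall k, (k < n)%nat -> DX n O T k p (Px k)) /\
    (forall j k, (j < n)%nat -> (k < n)%nat ->
       DX n O T j (u k) (U1 j k) /\ DX n O T j (U1 j k) (U2 j k)) /\
    (forall k, (k < n)%nat -> DX n O T k divu (V k)) /\
    DT n O T (fun x t => rho x t * e x t) Et /\
    (forall j, (j < n)%nat -> DX n O T j (fun x t => rho x t * e x t * u j x t) (W j)) /\
    (forall j, (j < n)%nat -> DX n O T j e (E1 j) /\ DX n O T j (E1 j) (E2 j)) /\
    (forall x t, O x -> 0 < t <= T ->
       Rt x t + sumR n (fun j => M j x t) = 0 /\
       (forall k, (k < n)%nat ->
          Mt k x t + sumR n (fun j => Q j k x t) + Px k x t =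
          mu * sumR n (fun j => U2 j k x t) + (mu + lam) * V k x t) /\
       Et x t + sumR n (fun j => W j x t) + p x t * divu x t =
       mu / 2 * sumR n (fun i => sumR n (fun j => (U1 j i x t + U1 i j x t) ^ 2))
       + lam * (divu x t) ^ 2
       + kappa * (gam - 1) / Rg * sumR n (fun j => E2 j x t)) /\
    (forall x t, boundary n O x -> 0 < t <= T ->
       e x t = 0 /\ forall i, (i < n)%nat -> E1 i x t = 0).

(* Main.v *)
(** By mass conservation the energy equation becomes
    [rho (e_t + u . grad e + (gam - 1) e div u) >= k Lap e].  If [rho] were positive in [O], the
    strong maximum principle and Hopf's lemma would contradict [grad e = 0] on the boundary.  But
    nothing is assumed about [u] on the boundary, so an inflow may make [rho] negative, and the
    equation backward parabolic, near the boundary.  This happens only in a layer of width [O(t)],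
    where moreover [- rho = O(t)].  There the Laplacian of a concave profile of width [B t] is of
    order [- 1 / t^2], which compensates the wrong sign: [exp (- c / t^2) (2 - exp (phi / (B t)))]
    is a strict supersolution on all of [O], hence negative parts of [e] are [O(exp (- c / t^2))].
    On the other hand heat spreads from a ball around a point [x0] with [e0 x0 > 0] at a rate
    bounded below by the subsolution [exp (- psi / t)], [psi] quadratic.  Near the points of the
    complement of [O] nearest to [x0] this subsolution increases inwards, so it cannot touch [e]
    from below on the boundary, where [e] vanishes to first order.  Hence at such a point
    [0 = e >= a (exp (- A1 / t) - exp (- A2 / t)) - M exp (- c / (4 t^2))], which is positive for
    small [t]. *)
Require Import Defs.
From Stdlib Require Import Reals Lra Lia Classical ClassicalEpsilon FunctionalExtensionality.
From Coquelicot Require Import Coquelicot.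
Open Scope R_scope.

(** Where [rho < 0] the equation runs backward in time, so a minimum attained at the final time of a
    comparison says nothing: the one-sided inequality for the time derivative gets the wrong sign
    after multiplication by [rho]. Contact has to occur strictly inside the time interval, where the
    two time derivatives agree. The final time [T0] is excluded by size alone: the weight is
    multiplied by so large a constant, of order [exp (c / T0 ^ 2)], that at [T0] the barrier lies
    below the lower bound of [e].

    The sign of [e] is not known in advance, so the spreading of heat and the control of negative
    parts are treated together: with [v] the subsolution and [w] the weight, the function
    [max (0, v) - m w] is slid below [e] with the least possible [m]. Its two smooth branches have
    the same form, with coefficient [a0] or 0 in front of the Gaussian part.

    The weight is taken at the shifted time [t + eps], which keeps it positive at time 0, so that
    the quotient by it is continuous on the closed cylinder. No bound depends on [eps], and the
    final choice [eps = t] produces the 4 in [exp (- c / (4 t^2))]. *)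

(** * Finite sums, coordinates and distances *)

Lemma sumR_ext (n : nat) (f g : nat -> R) :
  (forall j, (j < n)%nat -> f j = g j) -> sumR n f = sumR n g.
Proof.
  induction n as [|n IH]; intros H; simpl; [reflexivity|].
  rewrite IH by (intros; apply H; lia). rewrite (H n) by lia. reflexivity.
Qed.

Lemma sumR_plus (n : nat) (f g : nat -> R) :
  sumR n (fun j => f j + g j) = sumR n f + sumR n g.
Proof. induction n as [|n IH]; simpl; [|rewrite IH]; lra. Qed.

Lemma sumR_scal (n : nat) (a : R) (f : nat -> R) :
  sumR n (fun j => a * f j) = a * sumR n f.
Proof. induction n as [|n IH]; simpl; [|rewrite IH]; lra. Qed.

Lemma sumR_const (n : nat) (a : R) : sumR n (fun _ => a) = INR n * a.
Proof. induction n as [|n IH]; [simpl; lra|]. rewrite S_INR. simpl. rewrite IH. lra. Qed.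

Lemma sumR_le (n : nat) (f g : nat -> R) :
  (forall j, (j < n)%nat -> f j <= g j) -> sumR n f <= sumR n g.
Proof.
  induction n as [|n IH]; intros H; simpl; [lra|].
  assert (sumR n f <= sumR n g) by (apply IH; intros; apply H; lia).
  assert (f n <= g n) by (apply H; lia). lra.
Qed.

Lemma sumR_nonneg (n : nat) (f : nat -> R) :
  (forall j, (j < n)%nat -> 0 <= f j) -> 0 <= sumR n f.
Proof.
  intros H. replace 0 with (sumR n (fun _ => 0)) by (rewrite sumR_const; lra).
  now apply sumR_le.
Qed.

Lemma sumR_term_le (n : nat) (f : nat -> R) (i : nat) :
  (forall j, (j < n)%nat -> 0 <= f j) -> (i < n)%nat -> f i <= sumR n f.
Proof.
  induction n as [|n IH]; intros H Hi; [lia|]. simpl.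
  assert (0 <= sumR n f) by (apply sumR_nonneg; intros; apply H; lia).
  assert (0 <= f n) by (apply H; lia).
  destruct (Nat.eq_dec i n) as [->|Hn]; [lra|].
  assert (f i <= sumR n f) by (apply IH; [intros; apply H|]; lia). lra.
Qed.

Lemma sumR_pos_term (n : nat) (f : nat -> R) :
  0 < sumR n f -> exists j, (j < n)%nat /\ 0 < f j.
Proof.
  intros H. apply NNPP; intros Hn.
  assert (sumR n f <= sumR n (fun _ => 0)).
  { apply sumR_le; intros j Hj. apply Rnot_lt_le. intros H1. apply Hn. now exists j. }
  rewrite sumR_const in H0. lra.
Qed.

(** Cauchy-Schwarz against the constant 1; the inductive step is the expansion of the nonnegative
    sum of the [(f j - f n) ^ 2]. *)
Lemma sumR_sqr_le (n : nat) (f : nat -> R) :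
  (sumR n f) ^ 2 <= INR n * sumR n (fun j => f j ^ 2).
Proof.
  induction n as [|n IH]; [simpl; lra|].
  rewrite S_INR. cbn [sumR].
  set (s := sumR n f) in *. set (q := sumR n (fun j => f j ^ 2)) in *.
  assert (Hq : 0 <= sumR n (fun j => (f j - f n) ^ 2))
    by (apply sumR_nonneg; intros; apply pow2_ge_0).
  replace (sumR n (fun j => (f j - f n) ^ 2)) with (q - 2 * f n * s + INR n * f n ^ 2) in Hq.
  - nra.
  - unfold q, s. rewrite <- sumR_const, <- sumR_scal.
    replace (sumR n (fun j => f j ^ 2) - sumR n (fun j => 2 * f n * f j))
      with (sumR n (fun j => f j ^ 2) + sumR n (fun j => - (2 * f n) * f j))
      by (rewrite !sumR_scal; lra).
    rewrite <- !sumR_plus. apply sumR_ext; intros; ring.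
Qed.

Lemma pt_ext (n : nat) (x y : pt) :
  inRn n x -> inRn n y -> (forall j, (j < n)%nat -> x j = y j) -> x = y.
Proof.
  intros Hx Hy H. apply functional_extensionality; intros j.
  destruct (Nat.lt_ge_cases j n); [auto|rewrite Hx, Hy; auto].
Qed.

Lemma upd_same (x : pt) (i : nat) (s : R) : upd x i s i = s.
Proof. unfold upd. now rewrite Nat.eqb_refl. Qed.

Lemma upd_other (x : pt) (i j : nat) (s : R) : j <> i -> upd x i s j = x j.
Proof. unfold upd. intros H. now rewrite (proj2 (Nat.eqb_neq j i) H). Qed.

Lemma upd_upd (x : pt) (i : nat) (s r : R) : upd (upd x i s) i r = upd x i r.
Proof. apply functional_extensionality; intros j. unfold upd. now destruct (Nat.eqb j i). Qed.

Lemma upd_id (x : pt) (i : nat) : upd x i (x i) = x.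
Proof.
  apply functional_extensionality; intros j. unfold upd.
  destruct (Nat.eqb_spec j i); congruence.
Qed.

Lemma inRn_upd (n : nat) (x : pt) (i : nat) (s : R) :
  (i < n)%nat -> inRn n x -> inRn n (upd x i s).
Proof. intros Hi H j Hj. rewrite upd_other by lia. auto. Qed.

Lemma dist_coord (n : nat) (x y : pt) (j : nat) :
  (j < n)%nat -> Rabs (x j - y j) <= distn n x y.
Proof.
  intros Hj. unfold distn. rewrite <- sqrt_Rsqr_abs. apply sqrt_le_1_alt.
  replace (Rsqr (x j - y j)) with ((x j - y j) ^ 2) by (unfold Rsqr; ring).
  apply (sumR_term_le n (fun j => (x j - y j) ^ 2)); [intros; apply pow2_ge_0|auto].
Qed.

Lemma dist_le_coord (n : nat) (x y : pt) (d : R) :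
  0 <= d -> (forall j, (j < n)%nat -> Rabs (x j - y j) <= d) -> distn n x y <= INR n * d.
Proof.
  intros Hd H. unfold distn.
  destruct n as [|n]; [simpl; rewrite sqrt_0; lra|].
  assert (Hn : 1 <= INR (S n)) by (rewrite S_INR; pose proof (pos_INR n); lra).
  rewrite <- (sqrt_pow2 (INR (S n) * d)) by nra. apply sqrt_le_1_alt.
  apply Rle_trans with (sumR (S n) (fun _ => d ^ 2)).
  - apply sumR_le; intros j Hj. specialize (H j Hj).
    rewrite <- (pow2_abs (x j - y j)). pose proof (Rabs_pos (x j - y j)). nra.
  - rewrite sumR_const. pose proof (pow2_ge_0 d). nra.
Qed.

Lemma dist_upd (n : nat) (x : pt) (i : nat) (s : R) :
  (i < n)%nat -> distn n x (upd x i s) = Rabs (s - x i).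
Proof.
  intros Hi. unfold distn. rewrite <- sqrt_Rsqr_abs. f_equal.
  replace (sumR n (fun j => (x j - upd x i s j) ^ 2)) with
    (sumR n (fun j => if Nat.eqb j i then Rsqr (s - x i) else 0)).
  - induction n as [|n IH]; [lia|]. simpl.
    destruct (Nat.eq_dec n i) as [->|Hn].
    + rewrite Nat.eqb_refl.
      rewrite (sumR_ext i _ (fun _ => 0)).
      * rewrite sumR_const. lra.
      * intros j Hj. now rewrite (proj2 (Nat.eqb_neq j i)) by lia.
    + rewrite IH by lia. rewrite (proj2 (Nat.eqb_neq n i)) by lia. lra.
  - apply sumR_ext; intros j _. unfold upd, Rsqr. destruct (Nat.eqb_spec j i); [subst|]; ring.
Qed.

Lemma dist_self (n : nat) (x : pt) : distn n x x = 0.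
Proof.
  unfold distn. rewrite (sumR_ext n _ (fun _ => 0)) by (intros; ring).
  rewrite sumR_const, Rmult_0_r. apply sqrt_0.
Qed.

(** * Sequential compactness *)

Definition conv (n : nat) (X : nat -> pt) (x : pt) : Prop :=
  forall j, (j < n)%nat -> Un_cv (fun k => X k j) (x j).

(** Continuity on a subset of space-time is stated with sequences, so that its stability under
    algebraic operations is that of [Un_cv]. *)
Definition seq_cont (n : nat) (A : pt -> R -> Prop) (F : pt -> R -> R) : Prop :=
  forall X tau x t, (forall k, A (X k) (tau k)) -> A x t ->
    conv n X x -> Un_cv tau t -> Un_cv (fun k => F (X k) (tau k)) (F x t).

(** The Heine-Borel form of compactness. Convergence [conv] sees only the coordinates below [n],
    hence [inRn n x] is asked separately of the limit. *)
Definition seq_compact (n : nat) (A : pt -> R -> Prop) : Prop :=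
  (exists M, forall x t, A x t ->
     inRn n x /\ (forall j, (j < n)%nat -> Rabs (x j) <= M) /\ Rabs t <= M) /\
  (forall X tau x t, (forall k, A (X k) (tau k)) -> inRn n x ->
     conv n X x -> Un_cv tau t -> A x t).

(** Instead of increasing indices only [k <= s k] is required: this preserves limits, and it is what
    choosing indices near a cluster point provides. *)
Lemma Un_cv_subseq (u : nat -> R) (l : R) (s : nat -> nat) :
  (forall k, (k <= s k)%nat) -> Un_cv u l -> Un_cv (fun k => u (s k)) l.
Proof.
  intros Hs Hu eps He. destruct (Hu eps He) as [N HN]. exists N. intros k Hk.
  apply HN. specialize (Hs k). lia.
Qed.

Lemma inv_S_pos (k : nat) : 0 < / INR (S k).
Proof. apply Rinv_0_lt_compat, lt_0_INR. lia. Qed.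

Lemma Un_cv_inv_S : Un_cv (fun k => / INR (S k)) 0.
Proof.
  intros eps He. destruct (INR_archimed 1 (/ eps)) as [N HN]; [lra|].
  exists N. intros k Hk. unfold Rdist. rewrite Rminus_0_r.
  pose proof (inv_S_pos k). rewrite Rabs_pos_eq by lra.
  rewrite <- (Rinv_inv eps). apply Rinv_lt_contravar.
  - apply Rmult_lt_0_compat; [now apply Rinv_0_lt_compat|apply lt_0_INR; lia].
  - assert (INR N <= INR k) by (apply le_INR; lia). rewrite S_INR. lra.
Qed.

Lemma Un_cv_close (u v : nat -> R) (l : R) :
  Un_cv u l -> (forall k, Rabs (v k - u k) <= / INR (S k)) -> Un_cv v l.
Proof.
  intros Hu Hv eps He.
  destruct (Hu (eps / 2)) as [N1 H1]; [lra|].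
  destruct (Un_cv_inv_S (eps / 2)) as [N2 H2]; [lra|].
  exists (N1 + N2)%nat. intros k Hk. unfold Rdist in *.
  specialize (H1 k ltac:(lia)). specialize (H2 k ltac:(lia)). specialize (Hv k).
  pose proof (inv_S_pos k). rewrite Rminus_0_r, Rabs_pos_eq in H2 by lra.
  replace (v k - l) with ((v k - u k) + (u k - l)) by ring.
  eapply Rle_lt_trans; [apply Rabs_triang|]. lra.
Qed.

Lemma bounded_subseq (u : nat -> R) (M : R) :
  (forall k, Rabs (u k) <= M) ->
  exists (s : nat -> nat) (l : R), (forall k, (k <= s k)%nat) /\ Un_cv (fun k => u (s k)) l.
Proof.
  intros H.
  destruct (Bolzano_Weierstrass u (fun c => - M <= c <= M)) as [l Hl].
  - apply compact_P3.
  - intros k. now apply Rabs_le_between.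
  - assert (Hs : forall k, exists p, (k <= p)%nat /\ Rabs (u p - l) < / INR (S k)).
    { intros k. apply (Hl (disc l (mkposreal _ (inv_S_pos k))) k).
      exists (mkposreal _ (inv_S_pos k)). intros y Hy; exact Hy. }
    exists (fun k => proj1_sig (constructive_indefinite_description _ (Hs k))), l.
    split.
    + intros k. destruct constructive_indefinite_description as [p [Hp Hq]]; exact Hp.
    + apply (Un_cv_close (fun _ => l)).
      * intros eps He. exists 0%nat. intros. unfold Rdist. rewrite Rminus_diag, Rabs_R0; auto.
      * intros k. destruct constructive_indefinite_description as [p [Hq Hp]]; cbn [proj1_sig]; now left.
Qed.

Lemma bounded_conv_subseq (n : nat) (X : nat -> pt) (M : R) :
  (forall k j, (j < n)%nat -> Rabs (X k j) <= M) ->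
  exists (s : nat -> nat) (x : pt),
    (forall k, (k <= s k)%nat) /\ inRn n x /\ conv n (fun k => X (s k)) x.
Proof.
  induction n as [|n IH]; intros H.
  - exists (fun k => k), (fun _ => 0). split; [auto|split; [intros j _; auto|intros j Hj; lia]].
  - destruct IH as (s & x & Hs & Hx & Hc); [intros; apply H; lia|].
    destruct (bounded_subseq (fun k => X (s k) n) M) as (s' & l & Hs' & Hl).
    { intros k. apply H; lia. }
    exists (fun k => s (s' k)), (upd x n l). split; [|split].
    + intros k. specialize (Hs (s' k)). specialize (Hs' k). lia.
    + intros j Hj. rewrite upd_other by lia. apply Hx; lia.
    + intros j Hj. destruct (Nat.eq_dec j n) as [->|Hn].
      * rewrite upd_same. exact Hl.
      * rewrite upd_other by auto.
        apply (Un_cv_subseq (fun k => X (s k) j) (x j) s' Hs'). apply Hc; lia.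
Qed.

Lemma Un_cv_const (c : R) : Un_cv (fun _ => c) c.
Proof. intros eps He. exists 0%nat. intros. unfold Rdist. now rewrite Rminus_diag, Rabs_R0. Qed.

Lemma Un_cv_le_bound (u v : nat -> R) (l m : R) :
  Un_cv u l -> Un_cv v m -> (forall k, u k <= v k) -> l <= m.
Proof. intros Hu Hv H. exact (Rle_cv_lim H Hu Hv). Qed.

(** Counterexamples for [d = / INR (S k)] would subconverge to a point with [G <= 0] and [F <= 0].
    This one statement serves for boundedness, for attained minima, and for every passage from a
    strict inequality on a closed set to a uniform one nearby. *)
Lemma compact_uniform (n : nat) (A : pt -> R -> Prop) (F G : pt -> R -> R) :
  seq_compact n A -> seq_cont n A F -> seq_cont n A G ->
  (forall x t, A x t -> G x t <= 0 -> 0 < F x t) ->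
  exists d, 0 < d /\ forall x t, A x t -> G x t <= d -> d <= F x t.
Proof.
  intros [[M HM] Hcl] HF HG H. apply NNPP; intros Hn.
  assert (Hbad : forall k, exists p : pt * R,
    A (fst p) (snd p) /\ G (fst p) (snd p) <= / INR (S k) /\ F (fst p) (snd p) <= / INR (S k)).
  { intros k. apply NNPP; intros Hk. apply Hn. exists (/ INR (S k)). split; [apply inv_S_pos|].
    intros x t Hx Hg. apply Rnot_lt_le; intros Hf. apply Hk. exists (x, t); cbn [fst snd].
    repeat split; auto; lra. }
  set (p k := proj1_sig (constructive_indefinite_description _ (Hbad k))).
  assert (Hp : forall k, A (fst (p k)) (snd (p k)) /\ G (fst (p k)) (snd (p k)) <= / INR (S k)
                         /\ F (fst (p k)) (snd (p k)) <= / INR (S k)).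
  { intros k. unfold p. now destruct constructive_indefinite_description. }
  clearbody p.
  destruct (bounded_conv_subseq n (fun k => fst (p k)) M) as (s & x & Hs & Hx & Hc).
  { intros k j Hj. apply (HM _ _ (proj1 (Hp k))); auto. }
  destruct (bounded_subseq (fun k => snd (p (s k))) M) as (s' & t & Hs' & Ht).
  { intros k. apply (HM _ _ (proj1 (Hp (s k)))). }
  set (q k := p (s (s' k))).
  assert (Hss : forall k, (k <= s (s' k))%nat)
    by (intros k; specialize (Hs (s' k)); specialize (Hs' k); lia).
  assert (Hqc : conv n (fun k => fst (q k)) x)
    by (intros j Hj; apply (Un_cv_subseq (fun k => fst (p (s k)) j) (x j) s' Hs'); auto).
  assert (HA : A x t).
  { apply (Hcl (fun k => fst (q k)) (fun k => snd (q k))); auto. intros k. apply Hp. }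
  assert (Hinv : Un_cv (fun k => / INR (S (s (s' k)))) 0)
    by (apply (Un_cv_subseq (fun k => / INR (S k)) 0 (fun k => s (s' k)) Hss), Un_cv_inv_S).
  assert (G x t <= 0).
  { apply (Un_cv_le_bound (fun k => G (fst (q k)) (snd (q k))) (fun k => / INR (S (s (s' k))))); auto.
    - apply HG; auto. intros; apply Hp.
    - intros k. apply Hp. }
  assert (F x t <= 0).
  { apply (Un_cv_le_bound (fun k => F (fst (q k)) (snd (q k))) (fun k => / INR (S (s (s' k))))); auto.
    - apply HF; auto. intros; apply Hp.
    - intros k. apply Hp. }
  specialize (H x t HA H0). lra.
Qed.

Lemma seq_cont_const (n : nat) (A : pt -> R -> Prop) (c : R) : seq_cont n A (fun _ _ => c).
Proof. intros X tau x t _ _ _ _. apply Un_cv_const. Qed.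

Lemma seq_cont_time (n : nat) (A : pt -> R -> Prop) : seq_cont n A (fun _ t => t).
Proof. intros X tau x t _ _ _ H. exact H. Qed.

Lemma seq_cont_coord (n : nat) (A : pt -> R -> Prop) (j : nat) :
  (j < n)%nat -> seq_cont n A (fun x _ => x j).
Proof. intros Hj X tau x t _ _ H _. now apply H. Qed.

Lemma seq_cont_plus (n : nat) (A : pt -> R -> Prop) (F G : pt -> R -> R) :
  seq_cont n A F -> seq_cont n A G -> seq_cont n A (fun x t => F x t + G x t).
Proof.
  intros HF HG X tau x t H1 H2 H3 H4.
  apply (CV_plus (fun k => F (X k) (tau k)) (fun k => G (X k) (tau k))); auto.
Qed.

Lemma seq_cont_minus (n : nat) (A : pt -> R -> Prop) (F G : pt -> R -> R) :
  seq_cont n A F -> seq_cont n A G -> seq_cont n A (fun x t => F x t - G x t).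
Proof.
  intros HF HG X tau x t H1 H2 H3 H4.
  apply (CV_minus (fun k => F (X k) (tau k)) (fun k => G (X k) (tau k))); auto.
Qed.

Lemma seq_cont_mult (n : nat) (A : pt -> R -> Prop) (F G : pt -> R -> R) :
  seq_cont n A F -> seq_cont n A G -> seq_cont n A (fun x t => F x t * G x t).
Proof.
  intros HF HG X tau x t H1 H2 H3 H4.
  apply (CV_mult (fun k => F (X k) (tau k)) (fun k => G (X k) (tau k))); auto.
Qed.

Lemma seq_cont_comp (n : nat) (A : pt -> R -> Prop) (h : R -> R) (F : pt -> R -> R) :
  (forall x t, A x t -> continuity_pt h (F x t)) ->
  seq_cont n A F -> seq_cont n A (fun x t => h (F x t)).
Proof.
  intros Hh HF X tau x t H1 H2 H3 H4.
  apply (continuity_seq h (fun k => F (X k) (tau k))); auto.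
Qed.

Lemma seq_cont_sum (n m : nat) (A : pt -> R -> Prop) (F : nat -> pt -> R -> R) :
  (forall j, (j < m)%nat -> seq_cont n A (F j)) ->
  seq_cont n A (fun x t => sumR m (fun j => F j x t)).
Proof.
  induction m as [|m IH]; intros H; simpl; [apply seq_cont_const|].
  apply seq_cont_plus; [apply IH; intros|]; apply H; lia.
Qed.

Lemma seq_cont_inv (n : nat) (A : pt -> R -> Prop) (F : pt -> R -> R) :
  (forall x t, A x t -> F x t <> 0) -> seq_cont n A F -> seq_cont n A (fun x t => / F x t).
Proof.
  intros H. apply seq_cont_comp. intros x t Ha.
  apply (continuity_pt_inv (fun y => y)); [apply derivable_continuous_pt, derivable_pt_id|auto].
Qed.

Lemma continuity_exp (x : R) : continuity_pt exp x.
Proof. apply derivable_continuous_pt, derivable_pt_exp. Qed.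

Lemma seq_cont_Rmax (n : nat) (A : pt -> R -> Prop) (c : R) (F : pt -> R -> R) :
  seq_cont n A F -> seq_cont n A (fun x t => Rmax c (F x t)).
Proof.
  apply seq_cont_comp. intros x t _ eps He. exists eps. split; [lra|].
  intros y [_ Hy]. unfold dist in *; simpl in *; unfold Rdist in *.
  unfold Rmax. repeat destruct Rle_dec; unfold Rabs in *; repeat destruct Rcase_abs; lra.
Qed.

Lemma seq_cont_ext (n : nat) (A : pt -> R -> Prop) (F G : pt -> R -> R) :
  (forall x t, A x t -> F x t = G x t) -> seq_cont n A F -> seq_cont n A G.
Proof.
  intros E HF X tau x t H1 H2 H3 H4 eps He.
  destruct (HF X tau x t H1 H2 H3 H4 eps He) as [N HN]. exists N. intros k Hk.
  rewrite <- !E by auto. auto.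
Qed.

Lemma seq_cont_sub (n : nat) (A A' : pt -> R -> Prop) (F : pt -> R -> R) :
  (forall x t, A' x t -> A x t) -> seq_cont n A F -> seq_cont n A' F.
Proof. intros E HF X tau x t H1 H2 H3 H4. apply HF; auto. Qed.

Lemma compact_bounded (n : nat) (A : pt -> R -> Prop) (F : pt -> R -> R) :
  seq_compact n A -> seq_cont n A F -> exists B, 0 <= B /\ forall x t, A x t -> Rabs (F x t) <= B.
Proof.
  intros HA HF.
  assert (Hp : forall x t, 0 < 1 + F x t * F x t) by (intros; nra).
  (* A positive lower bound for [/ (1 + F ^ 2)] is an upper bound for [F ^ 2]. *)
  destruct (compact_uniform n A (fun x t => / (1 + F x t * F x t)) (fun _ _ => 0)) as (d & Hd & H).
  - exact HA.
  - apply seq_cont_inv; [intros x t _; specialize (Hp x t); lra|].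
    apply seq_cont_plus; [apply seq_cont_const|now apply seq_cont_mult].
  - apply seq_cont_const.
  - intros. now apply Rinv_0_lt_compat.
  - exists (/ d + 1). split; [pose proof (Rinv_0_lt_compat d Hd); lra|]. intros x t Hx. specialize (H x t Hx ltac:(lra)). specialize (Hp x t).
    apply Rinv_le_contravar in H; auto. rewrite Rinv_inv in H.
    pose proof (Rsqr_abs (F x t)) as E. unfold Rsqr in E. pose proof (Rabs_pos (F x t)). nra.
Qed.

(** If the supremum [m] of [- F] were not attained, [F + m] would be positive everywhere, hence at
    least some [d > 0], and [m - d] would be a smaller upper bound. *)
Lemma compact_min (n : nat) (A : pt -> R -> Prop) (F : pt -> R -> R) :
  seq_compact n A -> seq_cont n A F -> (exists x t, A x t) ->
  exists x t, A x t /\ forall y s, A y s -> F x t <= F y s.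
Proof.
  intros HA HF (x1 & t1 & H1). apply NNPP; intros Hn.
  destruct (compact_bounded n A F HA HF) as (B & _ & HB).
  destruct (completeness (fun r => exists x t, A x t /\ r = - F x t)) as [m [Hm1 Hm2]].
  - exists B. intros r (x & t & Hx & ->). specialize (HB x t Hx). apply Rabs_le_between in HB. lra.
  - exists (- F x1 t1). eauto.
  - assert (Hlt : forall x t, A x t -> 0 < F x t + m).
    { intros x t Hx. assert (- F x t <= m) by (apply Hm1; eauto).
      destruct (Req_dec (- F x t) m); [|lra]. exfalso. apply Hn. exists x, t. split; auto.
      intros y s Hy. assert (- F y s <= m) by (apply Hm1; eauto). lra. }
    destruct (compact_uniform n A (fun x t => F x t + m) (fun _ _ => 0)) as (d & Hd & H); auto.
    + apply seq_cont_plus; auto using seq_cont_const.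
    + apply seq_cont_const.
    + assert (m <= m - d); [|lra]. apply Hm2. intros r (x & t & Hx & ->).
      specialize (H x t Hx ltac:(lra)). lra.
Qed.

(** * Compactness of the closed space-time cylinder *)

Lemma closure_incl (n : nat) (O : pt -> Prop) (x : pt) : is_open n O -> O x -> closure n O x.
Proof.
  intros HO Hx. split; [now apply HO|]. intros r Hr. exists x. now rewrite dist_self.
Qed.

Lemma conv_dist (n : nat) (X : nat -> pt) (x : pt) (d : R) :
  0 < d -> conv n X x -> exists N, forall k, (N <= k)%nat -> distn n x (X k) < d.
Proof.
  intros Hd Hc. set (d' := d / (2 * (INR n + 1))).
  pose proof (pos_INR n) as Hn.
  assert (Hd' : 0 < d') by (apply Rdiv_lt_0_compat; lra).
  assert (Hk : forall m, (m <= n)%nat -> exists N, forall k, (N <= k)%nat ->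
        forall j, (j < m)%nat -> Rabs (x j - X k j) < d').
  { induction m as [|m IH]; intros Hm; [exists 0%nat; intros; lia|].
    destruct IH as [N1 H1]; [lia|]. destruct (Hc m ltac:(lia) d' Hd') as [N2 H2].
    exists (N1 + N2)%nat. intros k Hk j Hj. destruct (Nat.eq_dec j m) as [->|Hj'].
    - rewrite Rabs_minus_sym. apply H2. lia.
    - apply H1; lia. }
  destruct (Hk n) as [N HN]; auto. exists N. intros k Hk'.
  apply Rle_lt_trans with (INR n * d').
  - apply dist_le_coord; [lra|]. intros j Hj. left. now apply HN.
  - assert (E : (INR n + 1) * d' = d / 2) by (unfold d'; field; lra). nra.
Qed.

Lemma closure_closed (n : nat) (O : pt -> Prop) (X : nat -> pt) (x : pt) :
  (1 <= n)%nat -> (forall k, closure n O (X k)) -> inRn n x -> conv n X x -> closure n O x.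
Proof.
  intros Hn HX Hx Hc. split; auto. intros r Hr.
  set (d := r / (3 * INR n)).
  assert (Hn1 : 1 <= INR n) by (apply (le_INR 1); lia).
  assert (Hd : 0 < d) by (apply Rdiv_lt_0_compat; lra).
  destruct (conv_dist n X x d Hd Hc) as [N HN]. specialize (HN N (le_n N)).
  destruct (proj2 (HX N) d Hd) as (y & Hy & Hyd).
  exists y. split; auto.
  apply Rle_lt_trans with (INR n * (2 * d)).
  - apply dist_le_coord; [lra|]. intros j Hj.
    pose proof (dist_coord n x (X N) j Hj). pose proof (dist_coord n (X N) y j Hj).
    replace (x j - y j) with ((x j - X N j) + (X N j - y j)) by ring.
    eapply Rle_trans; [apply Rabs_triang|]. lra.
  - unfold d. replace (INR n * (2 * (r / (3 * INR n)))) with (2 / 3 * r) by (field; lra). lra.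
Qed.

Lemma closure_bounded (n : nat) (O : pt -> Prop) : is_bounded n O ->
  exists M, 0 < M /\ forall x, closure n O x -> forall j, (j < n)%nat -> Rabs (x j) <= M.
Proof.
  intros [M HM]. exists (Rabs M + 1). split; [pose proof (Rabs_pos M); lra|].
  intros x [_ Hx] j Hj. destruct (Hx 1) as (y & Hy & Hd); [lra|].
  pose proof (dist_coord n x y j Hj). pose proof (dist_coord n y (fun _ => 0) j Hj).
  specialize (HM y Hy). simpl in *. rewrite Rminus_0_r in H0.
  replace (x j) with ((x j - y j) + y j) by ring.
  eapply Rle_trans; [apply Rabs_triang|]. pose proof (Rle_abs M). lra.
Qed.

Lemma inK_compact (n : nat) (O : pt -> Prop) (T : R) :
  (1 <= n)%nat -> is_bounded n O -> 0 <= T -> seq_compact n (inK n O T).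
Proof.
  intros Hn HO HT. destruct (closure_bounded n O HO) as (M & HM & H). split.
  - exists (M + T). intros x t [Hx Ht]. split; [apply Hx|]. split.
    + intros j Hj. specialize (H x Hx j Hj). lra.
    + rewrite Rabs_pos_eq; lra.
  - intros X tau x t HX Hx Hc Ht. split; [|split].
    + apply (closure_closed n O X); auto. intros k; apply HX.
    + apply (Un_cv_le_bound (fun _ => 0) tau); auto using Un_cv_const. intros k; apply HX.
    + apply (Un_cv_le_bound tau (fun _ => T)); auto using Un_cv_const. intros k; apply HX.
Qed.

Lemma compact_sub (n : nat) (A : pt -> R -> Prop) (G : pt -> R -> R) :
  seq_compact n A -> seq_cont n A G -> seq_compact n (fun x t => A x t /\ 0 <= G x t).
Proof.
  intros [[M HM] Hcl] HG. split.
  - exists M. intros x t [H _]. now apply HM.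
  - intros X tau x t HX Hx Hc Ht.
    assert (HA : A x t) by (apply (Hcl X tau); auto; intros k; apply HX). split; auto.
    apply (Un_cv_le_bound (fun _ => 0) (fun k => G (X k) (tau k))); auto using Un_cv_const.
    + apply HG; auto. intros k; apply HX.
    + intros k; apply HX.
Qed.

Lemma cont_on_K_seq (n : nat) (O : pt -> Prop) (T : R) (F : pt -> R -> R) :
  cont_on_K n O T F -> seq_cont n (inK n O T) F.
Proof.
  intros HF X tau x t HX Hx Hc Ht eps He.
  destruct (HF x t Hx eps He) as (d & Hd & H).
  destruct (conv_dist n X x d Hd Hc) as [N1 H1]. destruct (Ht d Hd) as [N2 H2].
  exists (N1 + N2)%nat. intros k Hk. apply H; [apply HX|apply H1; lia|apply H2; lia].
Qed.

Lemma cont_Rn_seq (n : nat) (A : pt -> R -> Prop) (f : pt -> R) :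
  (forall x t, A x t -> inRn n x) -> (forall x, inRn n x -> cont_Rn n f x) ->
  seq_cont n A (fun x _ => f x).
Proof.
  intros HA Hf X tau x t HX Hx Hc Ht eps He.
  destruct (Hf x (HA _ _ Hx) eps He) as (d & Hd & H).
  destruct (conv_dist n X x d Hd Hc) as [N1 H1].
  exists N1. intros k Hk. apply H; [eapply HA, HX|apply H1; lia].
Qed.

(** * Derivatives at a minimum *)

Lemma deriv_right_min (g : R -> R) (x l d : R) :
  derivable_pt_lim g x l -> 0 < d -> (forall s, x < s < x + d -> g x <= g s) -> 0 <= l.
Proof.
  intros Hg Hd H. apply Rnot_lt_le; intros Hl.
  destruct (Hg (- l)) as [del Hdel]; [lra|].
  set (h := Rmin d del / 2). pose proof (cond_pos del).
  assert (Hh : 0 < h /\ h < d /\ h < del) by (unfold h, Rmin; destruct Rle_dec; lra).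
  specialize (Hdel h ltac:(lra) ltac:(rewrite Rabs_pos_eq; lra)).
  specialize (H (x + h) ltac:(lra)).
  assert (0 <= (g (x + h) - g x) / h) by (apply Rdiv_le_0_compat; lra).
  apply Rabs_lt_between in Hdel. lra.
Qed.

Lemma deriv_left_min (g : R -> R) (x l d : R) :
  derivable_pt_lim g x l -> 0 < d -> (forall s, x - d < s < x -> g x <= g s) -> l <= 0.
Proof.
  intros Hg Hd H. apply Rnot_lt_le; intros Hl.
  destruct (Hg l) as [del Hdel]; [lra|].
  set (h := Rmin d del / 2). pose proof (cond_pos del).
  assert (Hh : 0 < h /\ h < d /\ h < del) by (unfold h, Rmin; destruct Rle_dec; lra).
  specialize (Hdel (- h) ltac:(lra) ltac:(rewrite Rabs_Ropp, Rabs_pos_eq; lra)).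
  specialize (H (x - h) ltac:(lra)).
  assert (0 <= (g (x - h) - g x) / h) by (apply Rdiv_le_0_compat; lra).
  replace ((g (x + - h) - g x) / - h) with (- ((g (x - h) - g x) / h)) in Hdel
    by (unfold Rminus; field; lra).
  apply Rabs_lt_between in Hdel. lra.
Qed.

Lemma deriv_min (g : R -> R) (x l d : R) :
  derivable_pt_lim g x l -> 0 < d -> (forall s, Rabs (s - x) < d -> g x <= g s) -> l = 0.
Proof.
  intros Hg Hd H. apply Rle_antisym.
  - apply (deriv_left_min g x l d Hg Hd). intros s Hs. apply H. apply Rabs_def1; lra.
  - apply (deriv_right_min g x l d Hg Hd). intros s Hs. apply H. apply Rabs_def1; lra.
Qed.

(** If [l < 0], the slope [g1], which vanishes at [x], is negative just to the right of [x]; the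
    mean value theorem then puts [g] below [g x]. *)
Lemma second_deriv_min (g g1 : R -> R) (x l d : R) :
  0 < d -> (forall s, Rabs (s - x) < d -> derivable_pt_lim g s (g1 s)) ->
  derivable_pt_lim g1 x l -> (forall s, Rabs (s - x) < d -> g x <= g s) -> 0 <= l.
Proof.
  intros Hd Hg Hg1 H.
  assert (E : g1 x = 0).
  { apply (deriv_min g x _ d); auto. apply Hg. rewrite Rminus_diag, Rabs_R0; auto. }
  apply Rnot_lt_le; intros Hl.
  destruct (Hg1 (- l)) as [del Hdel]; [lra|].
  set (h := Rmin d del / 2). pose proof (cond_pos del).
  assert (Hh : 0 < h /\ h < d /\ h < del) by (unfold h, Rmin; destruct Rle_dec; lra).
  destruct (MVT_cor2 g g1 x (x + h)) as (c & Hc1 & Hc2); [lra| |].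
  - intros c Hc. apply Hg. rewrite Rabs_pos_eq; lra.
  - specialize (H (x + h) ltac:(rewrite Rabs_pos_eq; lra)).
    specialize (Hdel (c - x) ltac:(lra) ltac:(rewrite Rabs_pos_eq; lra)).
    replace (x + (c - x)) with c in Hdel by ring. rewrite E in Hdel.
    assert (0 <= g1 c) by nra.
    assert (0 <= (g1 c - 0) / (c - x)) by (apply Rdiv_le_0_compat; lra).
    apply Rabs_lt_between in Hdel. lra.
Qed.

Lemma open_coord (n : nat) (O : pt -> Prop) (x : pt) :
  is_open n O -> O x ->
  exists d, 0 < d /\ forall i s, (i < n)%nat -> Rabs (s - x i) < d -> O (upd x i s).
Proof.
  intros HO Hx. destruct (HO x Hx) as [Hin (r & Hr & H)]. exists r. split; auto.
  intros i s Hi Hs. apply H; [now apply inRn_upd|]. now rewrite dist_upd.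
Qed.

Lemma pd_upd (i : nat) (f : pt -> R) (x : pt) (s l : R) :
  pd i f (upd x i s) l -> derivable_pt_lim (fun r => f (upd x i r)) s l.
Proof.
  unfold pd. rewrite upd_same.
  replace (fun r => f (upd (upd x i s) i r)) with (fun r => f (upd x i r)); auto.
  apply functional_extensionality; intros r. now rewrite upd_upd.
Qed.

Lemma derivable_pt_lim_0_min (g : R -> R) (x l : R) (f : R -> R) (l' d : R) :
  derivable_pt_lim g x l -> derivable_pt_lim f x l' -> 0 < d ->
  (forall s, Rabs (s - x) < d -> g x - f x <= g s - f s) -> l = l'.
Proof.
  intros Hg Hf Hd H.
  assert (l - l' = 0); [|lra].
  apply (deriv_min (fun s => g s - f s) x _ d); auto.
  now apply (derivable_pt_lim_minus g f).
Qed.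

(** The minimum is two-sided in time, so the time derivatives are equal; an inequality would be
    useless, since their coefficient, the density, may have either sign. [D i s] is the slope of
    [Phi] at the point with [i]-th coordinate [s], kept as a function of [s] in order to be
    differentiated again. *)
Lemma touch_min (n : nat) (O : pt -> Prop) (T : R) (F Ft : pt -> R -> R)
  (F1 F2 : nat -> pt -> R -> R) (Phi : pt -> R -> R) (x : pt) (t d Pt : R)
  (D : nat -> R -> R) (P2 : nat -> R) :
  is_open n O -> O x -> 0 < t < T ->
  DT n O T F Ft ->
  (forall i, (i < n)%nat -> DX n O T i F (F1 i) /\ DX n O T i (F1 i) (F2 i)) ->
  derivable_pt_lim (fun s => Phi x s) t Pt ->
  (forall i s, (i < n)%nat -> Rabs (s - x i) < d ->
     derivable_pt_lim (fun r => Phi (upd x i r) t) s (D i s)) ->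
  (forall i, (i < n)%nat -> derivable_pt_lim (D i) (x i) (P2 i)) ->
  0 < d ->
  (forall s, Rabs (s - t) < d -> F x t - Phi x t <= F x s - Phi x s) ->
  (forall i s, (i < n)%nat -> Rabs (s - x i) < d ->
     F x t - Phi x t <= F (upd x i s) t - Phi (upd x i s) t) ->
  Ft x t = Pt /\ forall i, (i < n)%nat -> F1 i x t = D i (x i) /\ P2 i <= F2 i x t.
Proof.
  intros HO Hx Ht HFt HF HPt HD HP2 Hd Hmt Hmx. split.
  - apply (derivable_pt_lim_0_min (fun s => F x s) t _ (fun s => Phi x s) _ d); auto.
    now apply HFt.
  - intros i Hi. destruct (open_coord n O x HO Hx) as (d' & Hd' & HO').
    destruct (HF i Hi) as [[_ H1] [_ H2]].
    assert (Hx0 : Rabs (x i - x i) < d) by (rewrite Rminus_diag, Rabs_R0; auto).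
    assert (E : F1 i x t = D i (x i)).
    { apply (derivable_pt_lim_0_min (fun r => F (upd x i r) t) (x i) _
               (fun r => Phi (upd x i r) t) _ d); auto.
      - now apply H1.
      - intros s Hs. rewrite upd_id. auto. }
    split; auto.
    assert (0 <= F2 i x t - P2 i); [|lra].
    set (d'' := Rmin d d').
    assert (Hd'' : 0 < d'' /\ d'' <= d /\ d'' <= d') by (unfold d'', Rmin; destruct Rle_dec; lra).
    apply (second_deriv_min (fun r => F (upd x i r) t - Phi (upd x i r) t)
             (fun r => F1 i (upd x i r) t - D i r) (x i) _ d''); [lra| | |].
    + intros s Hs. apply (derivable_pt_lim_minus (fun r => F (upd x i r) t) (fun r => Phi (upd x i r) t)).
      * apply (pd_upd i (fun y => F y t)), H1; auto. apply HO'; auto; lra.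
      * apply HD; auto; lra.
    + apply (derivable_pt_lim_minus (fun r => F1 i (upd x i r) t) (D i)); auto.
      apply H2; auto.
    + intros s Hs. rewrite upd_id. apply Hmx; auto; lra.
Qed.

(** * Geometry of the boundary *)

Definition sqdist (n : nat) (c x : pt) : R := sumR n (fun j => (x j - c j) ^ 2).

Lemma sqdist_nonneg (n : nat) (c x : pt) : 0 <= sqdist n c x.
Proof. apply sumR_nonneg; intros; apply pow2_ge_0. Qed.

Lemma dist_sqdist (n : nat) (c x : pt) (r : R) :
  0 < r -> sqdist n c x < r ^ 2 -> distn n c x < r.
Proof.
  intros Hr H. unfold distn.
  replace (sumR n (fun j => (c j - x j) ^ 2)) with (sqdist n c x)
    by (apply sumR_ext; intros; ring).
  rewrite <- (sqrt_pow2 r) by lra. apply sqrt_lt_1_alt. split; auto using sqdist_nonneg.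
Qed.

Lemma seq_cont_sqdist (n : nat) (A : pt -> R -> Prop) (c : pt) :
  seq_cont n A (fun x _ => sqdist n c x).
Proof.
  apply (seq_cont_sum n n A (fun j x _ => (x j - c j) ^ 2)). intros j Hj.
  assert (H : seq_cont n A (fun x _ => x j - c j))
    by (apply seq_cont_minus; auto using seq_cont_coord, seq_cont_const).
  apply (seq_cont_ext n A (fun x _ => (x j - c j) * (x j - c j))); [intros; ring|].
  now apply seq_cont_mult.
Qed.

Definition shift (y k : pt) (s : R) : pt := fun j => y j + s * k j.

Lemma inRn_shift (n : nat) (y k : pt) (s : R) : inRn n y -> inRn n k -> inRn n (shift y k s).
Proof. intros Hy Hk j Hj. unfold shift. rewrite Hy, Hk by auto. ring. Qed.

Lemma sqdist_shift (n : nat) (c y k : pt) (s : R) :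
  sqdist n c (shift y k s) =
  sqdist n c y + 2 * s * sumR n (fun j => k j * (y j - c j)) + s ^ 2 * sumR n (fun j => k j ^ 2).
Proof.
  unfold sqdist. rewrite <- !sumR_scal, <- !sumR_plus.
  apply sumR_ext; intros. unfold shift. ring.
Qed.

(** The coordinates are moved one after the other: [part m s] has moved the first [m]. Each
    increment is treated by the mean value theorem along one axis and by the continuity of the
    partial derivative. *)
Lemma C1_directional (n : nat) (phi : pt -> R) (P : nat -> pt -> R) (y k : pt) :
  (forall i, (i < n)%nat -> forall x, inRn n x -> pd i phi x (P i x) /\ cont_Rn n (P i) x) ->
  inRn n y -> inRn n k ->
  derivable_pt_lim (fun s => phi (shift y k s)) 0 (sumR n (fun j => P j y * k j)).
Proof.
  intros HP Hy Hk.
  set (part m s := fun j => if Nat.ltb j m then y j + s * k j else y j).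
  assert (Hpart : forall m s, (m <= n)%nat -> inRn n (part m s)).
  { intros m s Hm j Hj. unfold part. destruct (Nat.ltb_spec j m); [lia|auto]. }
  assert (H : forall m, (m <= n)%nat ->
    derivable_pt_lim (fun s => phi (part m s)) 0 (sumR m (fun j => P j y * k j))).
  { induction m as [|m IH]; intros Hm.
    - simpl. replace (fun s => phi (part 0%nat s)) with (fun _ : R => phi y); [apply derivable_pt_lim_const|].
      apply functional_extensionality; intros s. f_equal.
    - simpl sumR.
      replace (fun s => phi (part (S m) s)) with
        (fun s => phi (part m s) + (phi (part (S m) s) - phi (part m s)))
        by (apply functional_extensionality; intros; ring).
      apply (derivable_pt_lim_plus (fun s => phi (part m s))
               (fun s => phi (part (S m) s) - phi (part m s))); [apply IH; lia|].
      intros eps He.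
      destruct (HP m ltac:(lia) y Hy) as [_ HPc].
      set (b := Rabs (k m) + 1). assert (Hb : 1 <= b) by (pose proof (Rabs_pos (k m)); unfold b; lra).
      destruct (HPc (eps / b)) as (d & Hd & HPd); [apply Rdiv_lt_0_compat; lra|].
      (* [K] dominates every [Rabs (k j)], so for [Rabs h < d / ((INR n + 1) * K)] all intermediate
         points stay within [d] of [y]. *)
      set (K := 1 + sumR n (fun j => Rabs (k j))).
      assert (HK : 1 <= K).
      { assert (0 <= sumR n (fun j => Rabs (k j))) by (apply sumR_nonneg; intros; apply Rabs_pos).
        unfold K; lra. }
      pose proof (pos_INR n) as HN.
      assert (Hdel : 0 < d / ((INR n + 1) * K)) by (apply Rdiv_lt_0_compat; nra).
      exists (mkposreal _ Hdel). intros h Hh Hhd. simpl in Hhd. rewrite Rplus_0_l.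
      replace (part m 0) with (part (S m) 0).
      2:{ apply functional_extensionality; intros j. unfold part.
          destruct (Nat.ltb j (S m)), (Nat.ltb j m); ring. }
      rewrite Rminus_diag, Rminus_0_r.
      set (z := part m h).
      assert (Ez : z m = y m) by (unfold z, part; now rewrite Nat.ltb_irrefl).
      assert (Es : part (S m) h = upd z m (y m + h * k m)).
      { apply functional_extensionality; intros j. unfold upd, z, part.
        destruct (Nat.eqb_spec j m) as [->|Hj].
        - now rewrite (proj2 (Nat.ltb_lt m (S m))) by lia.
        - destruct (Nat.ltb_spec j (S m)), (Nat.ltb_spec j m); auto; lia. }
      assert (Hnear : forall s, Rabs (s - y m) <= Rabs (h * k m) -> Rabs (P m (upd z m s) - P m y) < eps / b).
      { intros s Hs. apply HPd; [apply inRn_upd; [lia|now apply Hpart; lia]|].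
        apply Rle_lt_trans with (INR n * (Rabs h * K)).
        - apply dist_le_coord; [pose proof (Rabs_pos h); nra|]. intros j Hj.
          assert (Hkj : Rabs (k j) <= K).
          { assert (Rabs (k j) <= sumR n (fun j => Rabs (k j)))
              by (apply (sumR_term_le n (fun j => Rabs (k j))); auto; intros; apply Rabs_pos).
            unfold K; lra. }
          pose proof (Rabs_pos h). pose proof (Rabs_pos (k j)).
          destruct (Nat.eq_dec j m) as [->|Hjm].
          + rewrite upd_same, Rabs_minus_sym. rewrite Rabs_mult in Hs. nra.
          + rewrite upd_other by auto. unfold z, part. destruct (Nat.ltb j m).
            * replace (y j - (y j + h * k j)) with (- (h * k j)) by ring.
              rewrite Rabs_Ropp, Rabs_mult. nra.
            * rewrite Rminus_diag, Rabs_R0. nra.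
        - assert (E : (INR n + 1) * K * (d / ((INR n + 1) * K)) = d) by (field; nra).
          rewrite <- E. assert (0 < (INR n + 1) * K) by nra.
          pose proof (Rabs_pos h). nra. }
      assert (Hmvt : exists s, Rabs (s - y m) <= Rabs (h * k m) /\
          phi (part (S m) h) - phi z = P m (upd z m s) * (h * k m)).
      { rewrite Es.
        assert (Hder : forall s, derivable_pt_lim (fun r => phi (upd z m r)) s (P m (upd z m s))).
        { intros s. apply (pd_upd m phi), HP; [lia|]. apply inRn_upd; [lia|]. apply Hpart; lia. }
        assert (Ez' : upd z m (y m) = z) by (rewrite <- Ez; apply upd_id).
        destruct (Rtotal_order (h * k m) 0) as [Hlt|[Heq|Hgt]].
        - destruct (MVT_cor2 (fun r => phi (upd z m r)) (fun r => P m (upd z m r)) (y m + h * k m) (y m))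
            as (s & E & Hs); [lra|auto|].
          exists s. rewrite Ez' in E. split; [|nra].
          rewrite !Rabs_left by lra. lra.
        - exists (y m). rewrite Heq, Rplus_0_r, Ez', !Rminus_diag, Rabs_R0. split; lra.
        - destruct (MVT_cor2 (fun r => phi (upd z m r)) (fun r => P m (upd z m r)) (y m) (y m + h * k m))
            as (s & E & Hs); [lra|auto|].
          exists s. rewrite Ez' in E. split; [|nra].
          rewrite !Rabs_pos_eq by lra. lra. }
      destruct Hmvt as (s & Hs & E). rewrite E.
      replace (P m (upd z m s) * (h * k m) / h - P m y * k m)
        with ((P m (upd z m s) - P m y) * k m) by (field; auto).
      specialize (Hnear s Hs). rewrite Rabs_mult.
      assert (Eb : eps / b * b = eps) by (field; lra).
      assert (0 < eps / b) by (apply Rdiv_lt_0_compat; lra).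
      pose proof (Rabs_pos (k m)). pose proof (Rabs_pos (P m (upd z m s) - P m y)).
      unfold b in Eb at 2. nra. }
  replace (fun s => phi (shift y k s)) with (fun s => phi (part n s)); [now apply H|].
  apply functional_extensionality; intros s. f_equal.
  apply functional_extensionality; intros j. unfold part, shift.
  destruct (Nat.ltb_spec j n); auto. rewrite Hk by auto. ring.
Qed.

(** The part of the smoothness of the boundary that the barriers see: the gradient [P1] of the
    defining function and its pure second derivatives [P2], whose sum is the Laplacian. *)
Record defining_function (n : nat) (O : pt -> Prop) (phi : pt -> R) (P1 P2 : nat -> pt -> R) : Prop := {
  df_neg : forall x, inRn n x -> (O x <-> phi x < 0);
  df_cont : forall x, inRn n x -> cont_Rn n phi x;
  df_pd1 : forall i x, (i < n)%nat -> inRn n x -> pd i phi x (P1 i x);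
  df_pd2 : forall i x, (i < n)%nat -> inRn n x -> pd i (P1 i) x (P2 i x);
  df_cont1 : forall i x, (i < n)%nat -> inRn n x -> cont_Rn n (P1 i) x;
  df_cont2 : forall i x, (i < n)%nat -> inRn n x -> cont_Rn n (P2 i) x;
  df_grad : forall x, boundary n O x -> 0 < sumR n (fun i => P1 i x ^ 2) }.

Lemma smooth_boundary_defining (n : nat) (O : pt -> Prop) :
  smooth_boundary n O -> exists phi P1 P2, defining_function n O phi P1 P2.
Proof.
  intros (phi & (S & HS & Hcl) & Hneg & Hgrad).
  assert (Hder : forall g, S g -> exists Dg : nat -> pt -> R, forall i, (i < n)%nat ->
            S (Dg i) /\ forall x, inRn n x -> pd i g x (Dg i x)).
  { intros g Hg.
    assert (H : forall i, exists dg, (i < n)%nat -> S dg /\ forall x, inRn n x -> pd i g x (dg x)).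
    { intros i. destruct (Nat.lt_ge_cases i n) as [Hi|Hi].
      - destruct (proj2 (Hcl g Hg) i Hi) as (dg & Hdg). eauto.
      - exists g. intros; lia. }
    exists (fun i => proj1_sig (constructive_indefinite_description _ (H i))).
    intros i Hi. destruct constructive_indefinite_description as [dg Hdg]. now apply Hdg. }
  destruct (Hder phi HS) as (P1 & HP1).
  assert (H2 : forall i, exists dg, (i < n)%nat -> S dg /\ forall x, inRn n x -> pd i (P1 i) x (dg x)).
  { intros i. destruct (Nat.lt_ge_cases i n) as [Hi|Hi].
    - destruct (Hder (P1 i) (proj1 (HP1 i Hi))) as (D & HD). exists (D i). auto.
    - exists phi. intros; lia. }
  exists phi, P1, (fun i => proj1_sig (constructive_indefinite_description _ (H2 i))).
  split; auto.
  - intros. now apply Hcl.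
  - intros. now apply HP1.
  - intros. destruct constructive_indefinite_description as [dg Hdg]. now apply Hdg.
  - intros. apply Hcl; auto. now apply HP1.
  - intros. destruct constructive_indefinite_description as [dg Hdg]. apply Hcl; auto. now apply Hdg.
  - intros x Hx. destruct (Hgrad x Hx) as (i & l & Hi & Hl & Hl0).
    assert (P1 i x = l) by (eapply uniqueness_limite; [apply HP1|]; eauto; apply Hx).
    apply Rlt_le_trans with (P1 i x ^ 2).
    + apply pow2_gt_0. congruence.
    + apply (sumR_term_le n (fun i => P1 i x ^ 2)); auto. intros; apply pow2_ge_0.
Qed.

Lemma closure_phi_le (n : nat) (O : pt -> Prop) (phi : pt -> R) (P1 P2 : nat -> pt -> R) (x : pt) :
  is_open n O -> defining_function n O phi P1 P2 -> closure n O x -> phi x <= 0.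
Proof.
  intros HO D [Hx Hc]. apply Rnot_lt_le; intros Hp.
  destruct (df_cont _ _ _ _ _ D x Hx (phi x) Hp) as (d & Hd & H).
  destruct (Hc d Hd) as (y & Hy & Hyd).
  assert (Hiny : inRn n y) by now apply HO.
  specialize (H y Hiny Hyd). apply (df_neg _ _ _ _ _ D y Hiny) in Hy.
  apply Rabs_lt_between in H. lra.
Qed.

(** This turns the boundary into a closed condition on a continuous function, to which compactness
    applies. *)
Lemma boundary_iff (n : nat) (O : pt -> Prop) (phi : pt -> R) (P1 P2 : nat -> pt -> R) (x : pt) :
  is_open n O -> defining_function n O phi P1 P2 -> closure n O x ->
  (boundary n O x <-> 0 <= phi x).
Proof.
  intros HO D Hx. split.
  - intros [_ Hb]. apply Rnot_lt_le. intros H. apply Hb, (df_neg _ _ _ _ _ D); auto. apply Hx.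
  - intros H. split; auto. intros Ho. apply (df_neg _ _ _ _ _ D) in Ho; [lra|apply Hx].
Qed.

Lemma seq_cont_grad_sq (n : nat) (O : pt -> Prop) (phi : pt -> R) (P1 P2 : nat -> pt -> R)
  (A : pt -> R -> Prop) :
  defining_function n O phi P1 P2 -> (forall x t, A x t -> inRn n x) ->
  seq_cont n A (fun x _ => sumR n (fun i => P1 i x ^ 2)).
Proof.
  intros D HA. apply (seq_cont_sum n n A (fun j x _ => P1 j x ^ 2)). intros j Hj.
  apply (seq_cont_ext n A (fun x _ => P1 j x * P1 j x)); [intros; ring|].
  apply seq_cont_mult; apply cont_Rn_seq; auto; intros; now apply (df_cont1 _ _ _ _ _ D).
Qed.

Lemma grad_near_boundary (n : nat) (O : pt -> Prop) (phi : pt -> R) (P1 P2 : nat -> pt -> R) :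
  (1 <= n)%nat -> is_open n O -> is_bounded n O -> defining_function n O phi P1 P2 ->
  exists eta, 0 < eta /\
    forall x, closure n O x -> - eta <= phi x -> eta <= sumR n (fun i => P1 i x ^ 2).
Proof.
  intros Hn HO HOb D.
  destruct (compact_uniform n (inK n O 0) (fun x _ => sumR n (fun i => P1 i x ^ 2)) (fun x _ => 0 - phi x))
    as (d & Hd & H).
  - apply inK_compact; auto; lra.
  - eapply seq_cont_grad_sq; eauto. intros x t Hx; apply Hx.
  - apply seq_cont_minus; [apply seq_cont_const|]. apply cont_Rn_seq; [intros x t Hx; apply Hx|].
    apply (df_cont _ _ _ _ _ D).
  - intros x t Hx Hp. apply (df_grad _ _ _ _ _ D), (boundary_iff n O phi P1 P2); auto; [apply Hx|lra].
  - exists d. split; auto. intros x Hx Hp. apply (H x 0); [split; [auto|lra]|lra].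
Qed.

(* The first-order condition at a point [y] of the complement of [O] nearest to [x0]: testing with
   the direction [grad phi y - (y - x0)], which enters the ball around [x0] through [y] whenever
   the inner product [F] below is nonpositive. *)
Lemma nearest_outside (n : nat) (O : pt -> Prop) (phi : pt -> R) (P1 P2 : nat -> pt -> R) (x0 y : pt) :
  is_open n O -> defining_function n O phi P1 P2 -> inRn n x0 -> inRn n y ->
  0 <= phi y -> 0 < sqdist n x0 y ->
  (forall z, inRn n z -> sqdist n x0 z < sqdist n x0 y -> O z) ->
  boundary n O y /\ 0 < sumR n (fun j => P1 j y * (y j - x0 j)).
Proof.
  intros HO D Hx0 Hy Hp Hq Hball. set (q := sqdist n x0 y) in *.
  assert (Hb : boundary n O y).
  { assert (Hc : closure n O y).
    { split; auto. intros r Hr.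
      (* Moving [y] towards [x0] by the fraction [s < 1] enters the ball, hence [O], and covers a
         distance at most [s * (1 + q) < r]. *)
      set (s := r / ((1 + r) * (1 + q))).
      assert (E : s * (1 + q) = r / (1 + r)) by (unfold s; field; lra).
      assert (Er : r / (1 + r) * (1 + r) = r) by (field; lra).
      assert (Hr1 : 0 < r / (1 + r)) by (apply Rdiv_lt_0_compat; lra).
      assert (Hr2 : r / (1 + r) < r) by nra.
      assert (Hr3 : r / (1 + r) < 1) by nra.
      assert (Hs0 : 0 < s) by (apply Rdiv_lt_0_compat; nra).
      assert (Hs : s < 1) by nra.
      assert (Hsr : s * (1 + q) < r) by lra.
      set (k := fun j => x0 j - y j).
      assert (Hk : inRn n k) by (intros j Hj; unfold k; rewrite Hx0, Hy by auto; ring).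
      assert (Ek : sumR n (fun j => k j ^ 2) = q) by (apply sumR_ext; intros; unfold k; ring).
      exists (shift y k s). split.
      - apply Hball; [now apply inRn_shift|]. rewrite sqdist_shift, Ek. fold q.
        replace (sumR n (fun j => k j * (y j - x0 j))) with (- q); [assert (0 < s * q) by nra; nra|].
        replace (- q) with (- 1 * q) by ring. unfold q, sqdist.
        rewrite <- sumR_scal. apply sumR_ext; intros; unfold k; ring.
      - apply dist_sqdist; auto. rewrite sqdist_shift, Ek.
        replace (sqdist n y y) with 0.
        + replace (sumR n (fun j => k j * (y j - y j))) with 0.
          { assert (s ^ 2 * q <= (s * (1 + q)) ^ 2) by nra. assert ((s * (1 + q)) ^ 2 < r ^ 2) by nra. lra. }
          rewrite (sumR_ext n _ (fun _ => 0)) by (intros; ring). rewrite sumR_const; ring.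
        + unfold sqdist. rewrite (sumR_ext n _ (fun _ => 0)) by (intros; ring). rewrite sumR_const; ring. }
    apply (boundary_iff n O phi P1 P2); auto. }
  split; auto.
  apply Rnot_le_lt; intros HF. set (F := sumR n (fun j => P1 j y * (y j - x0 j))) in *.
  assert (Ha := df_grad _ _ _ _ _ D y Hb).
  set (k := fun j => if Nat.ltb j n then P1 j y - (y j - x0 j) else 0).
  assert (Hk : inRn n k) by (intros j Hj; unfold k; destruct (Nat.ltb_spec j n); [lia|auto]).
  assert (Hkj : forall j, (j < n)%nat -> k j = P1 j y - (y j - x0 j))
    by (intros j Hj; unfold k; destruct (Nat.ltb_spec j n); [auto|lia]).
  assert (E1 : sumR n (fun j => P1 j y * k j) + F = sumR n (fun j => P1 j y ^ 2)).
  { unfold F. rewrite <- sumR_plus. apply sumR_ext; intros j Hj. rewrite Hkj by auto. ring. }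
  assert (E2 : sumR n (fun j => k j * (y j - x0 j)) + q = F).
  { unfold F, q, sqdist. rewrite <- sumR_plus. apply sumR_ext; intros j Hj. rewrite Hkj by auto. ring. }
  set (k2 := sumR n (fun j => k j ^ 2)).
  assert (Hk2 : 0 <= k2) by (apply sumR_nonneg; intros; apply pow2_ge_0).
  assert (Hd : 0 < q / (k2 + 1)) by (apply Rdiv_lt_0_compat; lra).
  assert (Hdir : derivable_pt_lim (fun s => - phi (shift y k s)) 0 (- sumR n (fun j => P1 j y * k j))).
  { apply (derivable_pt_lim_opp (fun s => phi (shift y k s))).
    apply C1_directional; auto. intros i Hi x Hx. split.
    - now apply (df_pd1 _ _ _ _ _ D).
    - now apply (df_cont1 _ _ _ _ _ D). }
  assert (0 <= - sumR n (fun j => P1 j y * k j)); [|lra].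
  apply (deriv_right_min _ _ _ _ Hdir Hd). intros s Hs.
  replace (shift y k 0) with y by (apply functional_extensionality; intros; unfold shift; ring).
  assert (phi (shift y k s) < 0); [|lra].
  apply (df_neg _ _ _ _ _ D); [now apply inRn_shift|].
  apply Hball; [now apply inRn_shift|]. rewrite sqdist_shift. fold q k2.
  assert (Es : q / (k2 + 1) * (k2 + 1) = q) by (field; lra).
  assert (s * k2 < q) by nra. nra.
Qed.

Lemma outside_point (n : nat) (O : pt -> Prop) (x0 : pt) :
  (1 <= n)%nat -> is_bounded n O -> inRn n x0 -> exists y, inRn n y /\ ~ O y.
Proof.
  intros Hn [M HM] Hx. exists (upd x0 0 (Rabs M + 1)). split; [now apply inRn_upd|].
  intros H. specialize (HM _ H).
  pose proof (dist_coord n (upd x0 0 (Rabs M + 1)) (fun _ => 0) 0 Hn) as H1.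
  rewrite upd_same, Rminus_0_r, Rabs_pos_eq in H1 by (pose proof (Rabs_pos M); lra).
  pose proof (Rle_abs M). lra.
Qed.

(** Take [y0] nearest to [x0] in the complement of [O]. At each boundary point no farther than [y0]
    the outward gradient of [phi] makes an acute angle with the ray from [x0]; by compactness this
    persists, uniformly, at boundary points slightly farther away. The Gaussian is later cut off at
    that slightly larger radius. *)
Lemma visible_boundary (n : nat) (O : pt -> Prop) (phi : pt -> R) (P1 P2 : nat -> pt -> R) (x0 : pt) :
  (1 <= n)%nat -> is_open n O -> is_bounded n O -> defining_function n O phi P1 P2 -> O x0 ->
  exists y0 d, boundary n O y0 /\ 0 < d /\
    forall y, boundary n O y -> sqdist n x0 y <= sqdist n x0 y0 + d ->
      d <= sumR n (fun j => P1 j y * (y j - x0 j)).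
Proof.
  intros Hn HO HOb D Hx0. assert (Hin0 : inRn n x0) by now apply HO.
  destruct (outside_point n O x0 Hn HOb Hin0) as (y1 & Hy1 & Hy1O).
  assert (Hphi1 : forall y, inRn n y -> ~ O y -> 0 <= phi y).
  { intros y Hy HyO. apply Rnot_lt_le. intros H. apply HyO, (df_neg _ _ _ _ _ D); auto. }
  set (q1 := sqdist n x0 y1).
  (* The minimisation is confined to the closed ball through the known outside point [y1]. The time
     variable is a dummy, fixed at 0. *)
  set (A := fun (x : pt) (t : R) => inRn n x /\ sqdist n x0 x <= q1 /\ 0 <= phi x /\ t = 0).
  assert (HAc : seq_compact n A).
  { split.
    - exists (distn n x0 (fun _ => 0) + q1 + 1). intros x t (Hx & Hq & _ & ->).
      assert (Hq1 : 0 <= q1) by apply sqdist_nonneg.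
      assert (Hd0 : 0 <= distn n x0 (fun _ => 0)) by apply sqrt_pos.
      split; auto. split; [|rewrite Rabs_R0; lra]. intros j Hj.
      pose proof (dist_coord n x0 (fun _ => 0) j Hj) as H1. simpl in H1. rewrite Rminus_0_r in H1.
      assert (H2 : (x j - x0 j) ^ 2 <= q1).
      { eapply Rle_trans; [|apply Hq].
        apply (sumR_term_le n (fun j => (x j - x0 j) ^ 2)); auto. intros; apply pow2_ge_0. }
      assert (H3 : Rabs (x j - x0 j) <= q1 + 1).
      { rewrite <- pow2_abs in H2. pose proof (Rabs_pos (x j - x0 j)). nra. }
      replace (x j) with (x0 j + (x j - x0 j)) by ring.
      eapply Rle_trans; [apply Rabs_triang|]. lra.
    - intros X tau x t HX Hx Hc Ht.
      set (A' := fun (x : pt) (t : R) => inRn n x).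
      assert (HX' : forall k, A' (X k) (tau k)) by (intros k; apply HX).
      split; auto. repeat split.
      + apply (Un_cv_le_bound (fun k => sqdist n x0 (X k)) (fun _ => q1)); auto using Un_cv_const.
        * now apply (seq_cont_sqdist n A' x0 X tau x t).
        * intros k; apply HX.
      + apply (Un_cv_le_bound (fun _ => 0) (fun k => phi (X k))); auto using Un_cv_const.
        * apply (cont_Rn_seq n A' phi) with (tau := tau) (t := t); auto. apply (df_cont _ _ _ _ _ D).
        * intros k; apply HX.
      + apply (UL_sequence tau); auto. replace tau with (fun _ : nat => 0).
        * apply Un_cv_const.
        * apply functional_extensionality; intros k. symmetry. apply HX. }
  destruct (compact_min n A (fun x _ => sqdist n x0 x) HAc) as (y0 & t0 & Hy0 & Hmin).
  - apply seq_cont_sqdist.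
  - exists y1, 0. repeat split; auto. unfold q1; lra.
  - destruct Hy0 as (Hiny0 & Hq0 & Hp0 & _).
    assert (Hball : forall z, inRn n z -> sqdist n x0 z < sqdist n x0 y0 -> O z).
    { intros z Hz Hq. apply NNPP; intros Hzo.
      assert (sqdist n x0 y0 <= sqdist n x0 z); [|lra].
      apply (Hmin z 0). repeat split; auto. lra. }
    assert (Hq0p : 0 < sqdist n x0 y0).
    { destruct (Rle_lt_or_eq_dec _ _ (sqdist_nonneg n x0 y0)) as [H|H]; auto. exfalso.
      assert (y0 = x0).
      { apply (pt_ext n); auto. intros j Hj.
        assert ((y0 j - x0 j) ^ 2 <= 0).
        { rewrite H. apply (sumR_term_le n (fun j => (y0 j - x0 j) ^ 2)); auto. intros; apply pow2_ge_0. }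
        nra. }
      subst y0. apply (df_neg _ _ _ _ _ D) in Hx0; auto. lra. }
    destruct (compact_uniform n (fun x t => inK n O 0 x t /\ 0 <= phi x)
                (fun y _ => sumR n (fun j => P1 j y * (y j - x0 j)))
                (fun y _ => sqdist n x0 y - sqdist n x0 y0)) as (d & Hd & H).
    + apply (compact_sub n (inK n O 0) (fun x _ => phi x)).
      * apply inK_compact; auto; lra.
      * apply cont_Rn_seq; [intros x t Hx; apply Hx|]. apply (df_cont _ _ _ _ _ D).
    + apply (seq_cont_sum n n _ (fun j y _ => P1 j y * (y j - x0 j))). intros j Hj.
      apply seq_cont_mult.
      * apply cont_Rn_seq; [intros x t [Hx _]; apply Hx|]. intros. now apply (df_cont1 _ _ _ _ _ D).
      * apply seq_cont_minus; auto using seq_cont_coord, seq_cont_const.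
    + apply seq_cont_minus; auto using seq_cont_sqdist, seq_cont_const.
    + intros y t [Hy Hp] Hq. assert (Hiny : inRn n y) by apply Hy.
      assert (Hle : sqdist n x0 y0 <= sqdist n x0 y).
      { apply Rnot_lt_le. intros Hlt. apply Hball in Hlt; auto.
        apply (df_neg _ _ _ _ _ D) in Hlt; auto. lra. }
      eapply (nearest_outside n O phi P1 P2 x0 y); eauto; [lra|].
      intros z Hz Hzq. apply Hball; auto. lra.
    + exists y0, d. split; [|split; auto].
      * eapply (nearest_outside n O phi P1 P2 x0 y0); eauto.
      * intros y Hy Hq. apply (H y 0); [|lra].
        split; [split; [apply Hy|lra]|]. apply (boundary_iff n O phi P1 P2); auto. apply Hy.
Qed.

(** * The density near the boundary *)

(** The time derivative is available only at positive times: the mean value theorem is used on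
    [[s, t]] with small [s > 0], and continuity of [F] covers the rest. *)
Lemma DT_lower (n : nat) (O : pt -> Prop) (T B : R) (F Ft : pt -> R -> R) (x : pt) (t : R) :
  is_open n O -> cont_on_K n O T F -> DT n O T F Ft ->
  (forall x t, inK n O T x t -> Rabs (Ft x t) <= B) ->
  O x -> 0 <= t < T -> F x 0 - B * t <= F x t.
Proof.
  intros HO HF HFt HB Hx Ht. assert (Hc := closure_incl n O x HO Hx).
  destruct (Req_dec t 0) as [->|Ht0]; [lra|].
  apply Rnot_lt_le; intros Hlt.
  set (eps := F x 0 - B * t - F x t).
  destruct (HF x 0 ltac:(split; auto; lra) eps) as (d & Hd & H); [unfold eps; lra|].
  set (s := Rmin d t / 2).
  assert (Hs : 0 < s /\ s < d /\ s < t) by (unfold s, Rmin; destruct Rle_dec; lra).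
  specialize (H x s ltac:(split; auto; lra)). rewrite dist_self, Rminus_0_r, Rabs_pos_eq in H by lra.
  specialize (H ltac:(lra) ltac:(lra)). apply Rabs_lt_between in H.
  destruct (MVT_cor2 (fun r => F x r) (fun r => Ft x r) s t) as (c & Hc1 & Hc2); [lra| |].
  - intros c Hc'. apply HFt; auto; lra.
  - assert (HBc := HB x c ltac:(split; auto; lra)). apply Rabs_le_between in HBc.
    assert (- B * (t - s) <= Ft x c * (t - s)) by nra.
    assert (0 <= B) by lra. unfold eps in H. nra.
Qed.

Lemma cont_Rn_coord (n : nat) (f : pt -> R) (x : pt) (eps : R) :
  cont_Rn n f x -> inRn n x -> 0 < eps ->
  exists d, 0 < d /\ forall i s, (i < n)%nat -> Rabs (s - x i) < d -> Rabs (f (upd x i s) - f x) < eps.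
Proof.
  intros Hf Hx He. destruct (Hf eps He) as (d & Hd & H). exists d. split; auto.
  intros i s Hi Hs. apply H; [now apply inRn_upd|now rewrite dist_upd].
Qed.

(* The set [phi <= - C t] recedes from the boundary faster than the flow can carry boundary values
   inwards; the weight [- phi - C t] vanishes on its lateral boundary. *)
Lemma density_nonneg (n : nat) (O : pt -> Prop) (phi : pt -> R) (P1 P2 : nat -> pt -> R)
  (T T0 b : R) (rho Rt : pt -> R -> R) (R1 u : nat -> pt -> R -> R) (divu : pt -> R -> R) :
  (1 <= n)%nat -> is_open n O -> is_bounded n O -> defining_function n O phi P1 P2 ->
  0 < T0 < T -> cont_on_K n O T rho -> DT n O T rho Rt ->
  (forall j, (j < n)%nat -> DX n O T j rho (R1 j)) ->
  (forall x t, O x -> 0 < t <= T0 ->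
     Rt x t + sumR n (fun j => R1 j x t * u j x t) + rho x t * divu x t = 0) ->
  (forall x, O x -> 0 < rho x 0) ->
  (forall x t, O x -> 0 < t <= T0 -> Rabs (sumR n (fun j => P1 j x * u j x t)) <= b) ->
  (forall x t, O x -> 0 < t <= T0 -> Rabs (divu x t) <= b) ->
  (forall x, O x -> Rabs (phi x) <= b) ->
  forall x t, O x -> 0 <= t <= T0 -> phi x <= - (1 + b + b ^ 2) * t -> 0 <= rho x t.
Proof.
  intros Hn HO HOb D HT0 Hrc Hrt Hr1 Hpde Hr0 Hb1 Hb2 Hb3 x t Hx Ht Hphi.
  set (C := 1 + b + b ^ 2) in *.
  set (h := fun x t => rho x t * Rmax 0 ((0 - phi x) - C * t)).
  assert (Hb0 : 0 <= b) by (pose proof (Hb3 x Hx); pose proof (Rabs_pos (phi x)); lra).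
  assert (HA : seq_compact n (inK n O T0)) by (apply inK_compact; auto; lra).
  assert (Hphic : seq_cont n (inK n O T0) (fun x _ => phi x)).
  { apply cont_Rn_seq; [intros y s Hy; apply Hy|]. apply (df_cont _ _ _ _ _ D). }
  assert (Hcl : forall y, O y -> closure n O y) by (intros; now apply closure_incl).
  destruct (compact_min n (inK n O T0) h HA) as (y & s & Hy & Hmin).
  - apply seq_cont_mult.
    + apply (seq_cont_sub n (inK n O T)); [|now apply cont_on_K_seq].
      intros z r [Hz Hr]; split; auto; lra.
    + apply (seq_cont_Rmax n (inK n O T0) 0 (fun x t => (0 - phi x) - C * t)).
      apply seq_cont_minus; [apply seq_cont_minus; auto using seq_cont_const|].
      apply seq_cont_mult; auto using seq_cont_const, seq_cont_time.
  - exists x, 0. split; auto; lra.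
  - assert (Hh : 0 <= h y s).
    { apply Rnot_lt_le; intros Hneg. unfold h in Hneg.
      assert (Hchi : 0 < (0 - phi y) - C * s).
      { apply Rnot_le_lt; intros H. rewrite Rmax_left in Hneg by lra. lra. }
      rewrite Rmax_right in Hneg by lra.
      assert (Hrho : rho y s < 0) by nra.
      assert (HC : 1 <= C) by (unfold C; nra).
      destruct Hy as [Hyc Hs].
      assert (Hiny : inRn n y) by apply Hyc.
      assert (HyO : O y) by (apply (df_neg _ _ _ _ _ D); auto; nra).
      assert (Hs0 : 0 < s).
      { destruct (Req_dec s 0) as [->|]; [|lra]. specialize (Hr0 y HyO). lra. }
      destruct (cont_Rn_coord n phi y ((0 - phi y) - C * s)) as (d1 & Hd1 & Hphi1);
        auto; [now apply (df_cont _ _ _ _ _ D)|].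
      destruct (open_coord n O y HO HyO) as (d2 & Hd2 & HO2).
      set (d := Rmin d1 d2).
      assert (Hd : 0 < d /\ d <= d1 /\ d <= d2) by (unfold d, Rmin; destruct Rle_dec; lra).
      assert (Hgrad : forall i, (i < n)%nat ->
        R1 i y s * ((0 - phi y) - C * s) + rho y s * (0 - P1 i y - 0) = 0).
      { intros i Hi.
        apply (deriv_min (fun r => rho (upd y i r) s * ((0 - phi (upd y i r)) - C * s)) (y i) _ d); [|lra|].
        - pose proof (derivable_pt_lim_mult (fun r => rho (upd y i r) s)
            (fun r => (0 - phi (upd y i r)) - C * s) (y i) (R1 i y s) (0 - P1 i y - 0)) as E.
          cbv beta in E. rewrite !upd_id in E. apply E.
          + apply Hr1; auto; lra.
          + apply (derivable_pt_lim_minus (fun r => 0 - phi (upd y i r)) (fun _ => C * s)).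
            * apply (derivable_pt_lim_minus (fun _ => 0) (fun r => phi (upd y i r))).
              -- apply derivable_pt_lim_const.
              -- now apply (df_pd1 _ _ _ _ _ D).
            * apply derivable_pt_lim_const.
        - intros r Hr. rewrite !upd_id.
          specialize (Hmin (upd y i r) s). unfold h in Hmin.
          specialize (Hphi1 i r Hi ltac:(lra)). apply Rabs_lt_between in Hphi1.
          rewrite !Rmax_right in Hmin by lra. apply Hmin.
          split; [|lra]. apply Hcl, HO2; auto; lra. }
      (* Only earlier times are compared, because [s] may equal [T0]. For this first-order equation
         the one-sided inequality suffices. *)
      assert (Htime : Rt y s * ((0 - phi y) - C * s) + rho y s * (0 - C) <= 0).
      { apply (deriv_left_min (fun r => rho y r * ((0 - phi y) - C * r)) s _ s); auto.
        - apply (derivable_pt_lim_mult (fun r => rho y r) (fun r => (0 - phi y) - C * r)).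
          + apply Hrt; auto; lra.
          + apply (derivable_pt_lim_minus (fun _ => 0 - phi y) (fun r => C * r)).
            * apply derivable_pt_lim_const.
            * pose proof (derivable_pt_lim_scal (fun r => r) C s 1 (derivable_pt_lim_id s)) as E.
              rewrite Rmult_1_r in E. exact E.
        - intros r Hr. specialize (Hmin y r). unfold h in Hmin.
          rewrite !Rmax_right in Hmin by nra. apply Hmin. split; auto; lra. }
      set (chi := (0 - phi y) - C * s) in *.
      specialize (Hpde y s HyO ltac:(lra)).
      specialize (Hb1 y s HyO ltac:(lra)). specialize (Hb2 y s HyO ltac:(lra)). specialize (Hb3 y HyO).
      apply Rabs_le_between in Hb1, Hb2, Hb3.
      assert (Hsum : chi * sumR n (fun j => R1 j y s * u j y s) =
                     rho y s * sumR n (fun j => P1 j y * u j y s)).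
      { rewrite <- !sumR_scal. apply sumR_ext; intros j Hj. specialize (Hgrad j Hj).
        assert (E : R1 j y s * chi = rho y s * P1 j y) by lra.
        replace (chi * (R1 j y s * u j y s)) with (R1 j y s * chi * u j y s) by ring. rewrite E. ring. }
      assert (Hchib : chi <= b) by (unfold chi; nra).
      set (S1 := sumR n (fun j => P1 j y * u j y s)) in *.
      assert (E : Rt y s * chi = - rho y s * (S1 + chi * divu y s)).
      { replace (Rt y s) with (- sumR n (fun j => R1 j y s * u j y s) - rho y s * divu y s) by lra.
        rewrite Rmult_minus_distr_r. replace (- sumR n (fun j => R1 j y s * u j y s) * chi)
          with (- (chi * sumR n (fun j => R1 j y s * u j y s))) by ring.
        rewrite Hsum. ring. }
      assert (Habs : - b ^ 2 <= chi * divu y s).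
      { assert (chi * - b <= chi * divu y s) by (apply Rmult_le_compat_l; lra). nra. }
      (* By [Htime] and [E], [- rho * (S1 + chi * divu + C) <= 0] with [rho < 0]. The summands [b]
         and [b ^ 2] of [C] absorb [S1] and [chi * divu], and 1 remains. *)
      assert (0 < S1 + chi * divu y s + C) by (unfold C; lra).
      nra. }
    apply Rnot_lt_le; intros Hlt.
    destruct (Req_dec (phi x) (- C * t)) as [Ee|Hne].
    + (* the weight vanishes on the lateral boundary, so pass to earlier times *)
      destruct (Req_dec t 0) as [->|Ht0]; [specialize (Hr0 x Hx); lra|].
      destruct (Hrc x t) with (eps := - rho x t) as (d & Hd & Hcont);
        [split; auto; lra|lra|].
      set (r := t - Rmin d t / 2).
      assert (Hr : 0 <= r < t /\ t - r < d) by (unfold r, Rmin; destruct Rle_dec; lra).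
      specialize (Hcont x r). rewrite dist_self in Hcont.
      specialize (Hcont ltac:(split; auto; lra) Hd ltac:(rewrite Rabs_left; lra)).
      apply Rabs_lt_between in Hcont.
      specialize (Hmin x r ltac:(split; auto; lra)). unfold h in Hmin at 2.
      assert (1 <= C) by (unfold C; nra).
      assert (0 < (0 - phi x) - C * r) by nra.
      rewrite Rmax_right in Hmin by lra.
      assert (rho x r * ((0 - phi x) - C * r) < 0) by nra. lra.
    + specialize (Hmin x t ltac:(split; auto; lra)). unfold h in Hmin at 2.
      assert (0 < (0 - phi x) - C * t) by lra.
      rewrite Rmax_right in Hmin by lra.
      assert (rho x t * ((0 - phi x) - C * t) < 0) by nra. lra.
Qed.

(** * Barriers *)

Lemma exp_ge_third (z : R) : - 1 <= z -> / 3 <= exp z.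
Proof.
  intros H. apply Rle_trans with (exp (- (1))).
  - rewrite exp_Ropp. apply Rinv_le_contravar; [apply exp_pos|]. apply exp_le_3.
  - destruct H as [H|<-]; [left; apply exp_increasing|right; f_equal]; lra.
Qed.

Lemma mul_exp_bound (z : R) : z <= 0 -> - 1 <= z * exp z <= 0.
Proof.
  intros Hz. pose proof (exp_pos z). split; [|nra].
  pose proof (exp_ineq1_le (- z)) as H1. rewrite exp_Ropp in H1.
  assert (E : / exp z * exp z = 1) by (field; lra). nra.
Qed.

Lemma Rdiv_le_bound (a b c : R) : 0 < b -> a <= c * b -> a / b <= c.
Proof. intros Hb H. apply Rmult_le_reg_r with b; auto. unfold Rdiv. rewrite Rmult_assoc, Rinv_l; lra. Qed.

(* [X] stands for [exp (phi / (B tau))]: the weight [exp (- c / tau^2) (2 - X)] is a strict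
   supersolution of the heat operator even where [rho < 0], because there [- phi <= B tau] and
   the Laplacian of [- X] is of order [- 1 / tau^2]. *)
Lemma weight_super (k B c eta rm rho phi uphi U A1 A2 t tau : R) :
  0 < k -> 1 <= B -> 0 < eta -> 0 < rm -> c = k * eta / (60 * B ^ 3) ->
  0 < t <= tau -> tau <= 1 -> 4 * B * tau ^ 2 <= c -> k * tau ^ 2 < rm * c ->
  2 * B ^ 2 * tau <= eta ->
  phi <= 0 -> Rabs uphi <= B -> Rabs U <= B -> - B <= A2 -> 0 <= A1 ->
  (- eta <= phi -> eta <= A1) -> (phi <= - eta -> rm <= rho) ->
  - B * t <= rho -> (phi <= - B * t -> 0 <= rho) ->
  let X := exp (phi / (B * tau)) in
  0 < rho * (2 * c / tau ^ 3 * (2 - X) + X * phi / (B * tau ^ 2) - X * uphi / (B * tau) + U * (2 - X))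
      + k * (X * (A1 / (B * tau) ^ 2 + A2 / (B * tau))).
Proof.
  intros Hk HB Heta Hrm Hc Ht Htau1 Hs1 Hs2 Hs3 Hphi Hu HU HA2 HA1 Hnear Hfar Hrho1 Hrho2 X.
  set (z := phi / (B * tau)) in *.
  assert (Htau : 0 < tau) by lra.
  assert (HBt : 0 < B * tau) by nra.
  assert (Ez : z * (B * tau) = phi) by (unfold z; field; lra).
  assert (Hz : z <= 0) by nra.
  assert (HX : 0 < X) by apply exp_pos.
  assert (HX1 : X <= 1).
  { unfold X. rewrite <- exp_0. destruct Hz as [Hz| ->]; [left; now apply exp_increasing|lra]. }
  pose proof (mul_exp_bound z Hz) as HzX. fold X in HzX.
  apply Rabs_le_between in Hu, HU.
  set (s := / tau).
  assert (Es : s * tau = 1) by (unfold s; field; lra).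
  assert (Hs : 1 <= s) by nra.
  set (y := uphi / B).
  assert (Hy : - 1 <= y <= 1).
  { assert (E : y * B = uphi) by (unfold y; field; lra). nra. }
  set (a := A1 / B ^ 2). set (g := A2 / B).
  assert (Ea : a * B ^ 2 = A1) by (unfold a; field; lra).
  assert (Eg : g * B = A2) by (unfold g; field; lra).
  assert (HB2 : 1 <= B ^ 2) by nra.
  assert (Ha0 : 0 <= a) by nra.
  assert (Hg : - 1 <= g) by nra.
  assert (Hcp : 0 < c).
  { rewrite Hc. apply Rdiv_lt_0_compat; nra. }
  set (br := 2 * c * s ^ 3 * (2 - X) + (z * X) * s - X * y * s + U * (2 - X)).
  replace (2 * c / tau ^ 3 * (2 - X) + X * phi / (B * tau ^ 2) - X * uphi / (B * tau) + U * (2 - X))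
    with br.
  2:{ unfold br, s, y, z. field. lra. }
  replace (X * (A1 / (B * tau) ^ 2 + A2 / (B * tau))) with (X * (a * s ^ 2 + g * s)).
  2:{ unfold a, g, s. field. lra. }
  assert (Hcs : 4 * B <= c * s ^ 2).
  { replace (4 * B) with (4 * B * tau ^ 2 * s ^ 2).
    - apply Rmult_le_compat_r; auto. nra.
    - replace (4 * B * tau ^ 2 * s ^ 2) with (4 * B * (s * tau) ^ 2) by ring. rewrite Es. ring. }
  assert (Hcs3 : 4 * B * s <= c * s ^ 3) by (replace (c * s ^ 3) with (c * s ^ 2 * s) by ring; nra).
  assert (HXy : - 1 <= X * y <= 1) by nra.
  assert (HUX : - (2 * B) <= U * (2 - X) <= 2 * B) by nra.
  assert (Hs3p : 0 < s ^ 3) by (apply pow_lt; lra).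
  assert (Hcs3p : 0 < c * s ^ 3) by (apply Rmult_lt_0_compat; lra).
  (* The time derivative of [exp (- c / tau ^ 2)] dominates the bracket: as [1 <= 2 - X <= 2] it
     contributes between 2 and 4 times [c * s ^ 3], and by [Hcs3] the other terms amount to at most
     [4 * B * s <= c * s ^ 3]. *)
  assert (Hbr12 : c * s ^ 3 <= br <= 5 * (c * s ^ 3)).
  { unfold br.
    assert (E1 : 2 * c * s ^ 3 * (2 - X) = 2 * (c * s ^ 3 * (2 - X))) by ring.
    assert (c * s ^ 3 * 1 <= c * s ^ 3 * (2 - X) <= c * s ^ 3 * 2)
      by (split; apply Rmult_le_compat_l; lra).
    assert (- s <= z * X * s <= 0) by (clear - Hs HzX; nra).
    assert (- s <= X * y * s <= s) by (clear - Hs HXy; nra).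
    assert (s <= B * s) by (clear - Hs HB; nra). assert (B <= B * s) by (clear - Hs HB; nra). lra. }
  destruct Hbr12 as [Hb1 Hb2].
  assert (Hbr : 0 < br) by lra.
  (* Far from the boundary [rho >= rm] and the time term wins. Near it, either [rho >= 0] and both
     terms have the good sign, or [rho < 0] and the Laplacian must pay. *)
  destruct (Rle_dec phi (- eta)) as [Hp|Hp].
  - specialize (Hfar Hp).
    assert (Hlow : - s <= X * (a * s ^ 2 + g * s)).
    { assert (0 <= X * (a * s ^ 2)).
      { apply Rmult_le_pos; [lra|]. apply Rmult_le_pos; [lra|apply pow2_ge_0]. }
      assert (- 1 <= X * g) by (clear - HX HX1 Hg; nra).
      assert (- s <= X * g * s) by (clear - H0 Hs; nra). lra. }
    assert (H1 : k * s < rm * (c * s ^ 3)).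
    { replace (k * s) with (k * tau ^ 2 * s ^ 3).
      - replace (rm * (c * s ^ 3)) with (rm * c * s ^ 3) by ring. now apply Rmult_lt_compat_r.
      - replace (k * tau ^ 2 * s ^ 3) with (k * (s * tau) ^ 2 * s) by ring. rewrite Es. ring. }
    assert (rm * (c * s ^ 3) <= rho * br) by (apply Rmult_le_compat; lra).
    assert (k * - s <= k * (X * (a * s ^ 2 + g * s))) by (apply Rmult_le_compat_l; lra). lra.
  - specialize (Hnear ltac:(lra)).
    assert (Hlow : X * (eta / B ^ 2 / 2 * s ^ 2) <= X * (a * s ^ 2 + g * s)).
    { apply Rmult_le_compat_l; [lra|].
      set (e2 := eta / B ^ 2). assert (Ee : e2 * B ^ 2 = eta) by (unfold e2; field; lra).
      assert (e2 <= a) by (clear - Ee Ea HB2 Hnear; nra).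
      assert (2 * tau <= e2) by (clear - Ee Hs3 HB2; nra).
      assert (2 * s <= e2 * s ^ 2).
      { replace (2 * s) with (2 * tau * s ^ 2);
          [apply Rmult_le_compat_r; [apply pow2_ge_0|lra]|].
        replace (2 * tau * s ^ 2) with (2 * (s * tau) * s) by ring. rewrite Es. ring. }
      assert (e2 * s ^ 2 <= a * s ^ 2) by (apply Rmult_le_compat_r; [apply pow2_ge_0|lra]).
      assert (- s <= g * s) by (clear - Hg Hs; nra). lra. }
    assert (Hpos : 0 < eta / B ^ 2 / 2 * s ^ 2).
    { apply Rmult_lt_0_compat; [|apply pow_lt; lra]. repeat apply Rdiv_lt_0_compat; lra. }
    destruct (Rle_dec 0 rho) as [Hr|Hr].
    + assert (0 <= rho * br) by (apply Rmult_le_pos; lra).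
      assert (0 < X * (eta / B ^ 2 / 2 * s ^ 2)) by now apply Rmult_lt_0_compat.
      assert (0 < k * (X * (a * s ^ 2 + g * s))) by (apply Rmult_lt_0_compat; lra). lra.
    + assert (Hphi2 : - B * tau < phi).
      { apply Rnot_le_lt; intros H. apply Hr, Hrho2. clear - H Ht HB. nra. }
      assert (HX3 : / 3 <= X) by (apply exp_ge_third; clear - Ez HBt Hphi2; nra).
      assert (Hr2 : - B * tau <= rho) by (clear - Hrho1 Ht HB; nra).
      assert (H1 : - (5 * B * c * s ^ 2) <= rho * br).
      { replace (5 * B * c * s ^ 2) with (B * tau * (5 * (c * s ^ 3))).
        - clear - Hr2 Hr Hbr Hb2 HBt. nra.
        - replace (B * tau * (5 * (c * s ^ 3))) with (5 * B * c * s ^ 2 * (s * tau)) by ring. rewrite Es. ring. }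
      assert (H2 : / 3 * (eta / B ^ 2 / 2 * s ^ 2) <= X * (a * s ^ 2 + g * s)).
      { eapply Rle_trans; [apply Rmult_le_compat_r; [lra|exact HX3]|exact Hlow]. }
      (* Origin of the 60 in [c]: the backward term costs at most [5 * B * c * s ^ 2], the
         Laplacian, with [X >= / 3], yields at least [k * eta / (6 * B ^ 2) * s ^ 2], and [c] makes
         the cost half of the yield. *)
      assert (H3 : 5 * B * c = k * eta / B ^ 2 / 12) by (rewrite Hc; field; lra).
      rewrite H3 in H1.
      assert (H4 : 0 < k * (eta / B ^ 2 / 2 * s ^ 2)) by (apply Rmult_lt_0_compat; lra).
      apply (Rmult_le_compat_l k) in H2; [|lra].
      replace (k * eta / B ^ 2 / 12 * s ^ 2) with (/ 6 * (k * (eta / B ^ 2 / 2 * s ^ 2))) in H1 by (field; lra).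
      lra.
Qed.

(** The sign of [rho] does not matter: transport and time derivative are at most [E * N / t ^ 2]
    times a constant, whereas the Laplacian contains [4 * N * q] times [E * N / t ^ 2]. The
    additional factor [N] wins as soon as [q] stays above [r2]. Subtracting [EL] makes the profile
    vanish at [q - h = l]. *)
Lemma gaussian_sub (k B N nn h r2 l rho uq U q t : R) :
  0 < k -> 1 <= B -> 1 <= N -> 0 <= nn -> 0 < t <= 1 ->
  B * (2 * l + 3 * B) <= k * (4 * N * r2 - 2 * nn) -> r2 <= q -> h <= r2 -> q - h <= l ->
  Rabs rho <= B -> Rabs uq <= B -> Rabs U <= B ->
  let E := exp (- (N * (q - h)) / t) in let EL := exp (- (N * l) / t) in
  rho * (E * (N * (q - h)) / t ^ 2 - EL * (N * l) / t ^ 2 - E * (2 * N / t) * uq + U * (E - EL))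
   <= k * (E * (4 * N ^ 2 * q / t ^ 2 - 2 * nn * N / t)).
Proof.
  intros Hk HB HN Hnn Ht HNbig Hq Hh Hl Hrho Hu HU E EL.
  assert (HE : 0 < E) by apply exp_pos. assert (HEL : 0 < EL) by apply exp_pos.
  set (s := / t). assert (Es : s * t = 1) by (unfold s; field; lra). assert (Hs : 1 <= s) by nra.
  assert (HEE : EL <= E).
  { unfold E, EL, Rdiv. fold s. destruct (Req_dec (q - h) l) as [->|Hne]; [lra|].
    left. apply exp_increasing. assert (0 < N * s) by nra. nra. }
  replace (E * (N * (q - h)) / t ^ 2 - EL * (N * l) / t ^ 2 - E * (2 * N / t) * uq + U * (E - EL))
    with (E * (N * (q - h)) * s ^ 2 - EL * (N * l) * s ^ 2 - E * (2 * N * s) * uq + U * (E - EL))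
    by (unfold s; field; lra).
  replace (E * (4 * N ^ 2 * q / t ^ 2 - 2 * nn * N / t)) with (E * N * (4 * N * q * s ^ 2 - 2 * nn * s))
    by (unfold s; field; lra).
  assert (Hw : 0 < E * N * s ^ 2) by (apply Rmult_lt_0_compat; nra).
  set (Z := E * (N * (q - h)) * s ^ 2 - EL * (N * l) * s ^ 2 - E * (2 * N * s) * uq + U * (E - EL)).
  assert (HZ : Rabs Z <= E * N * s ^ 2 * (2 * l + 3 * B)).
  { apply Rabs_le_between in Hu, HU.
    assert (H1 : 0 <= E * (N * (q - h)) * s ^ 2 <= E * N * s ^ 2 * l).
    { replace (E * (N * (q - h)) * s ^ 2) with (E * N * s ^ 2 * (q - h)) by ring. nra. }
    assert (H2 : 0 <= EL * (N * l) * s ^ 2 <= E * N * s ^ 2 * l).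
    { replace (EL * (N * l) * s ^ 2) with (EL * (N * s ^ 2 * l)) by ring.
      replace (E * N * s ^ 2 * l) with (E * (N * s ^ 2 * l)) by ring.
      assert (0 <= N * s ^ 2 * l) by (apply Rmult_le_pos; nra). nra. }
    assert (H3 : Rabs (E * (2 * N * s) * uq) <= E * N * s ^ 2 * (2 * B)).
    { replace (E * (2 * N * s) * uq) with (E * N * s * (2 * uq)) by ring.
      assert (Hp : 0 < E * N * s) by (apply Rmult_lt_0_compat; nra).
      assert (Hp2 : E * N * s <= E * N * s ^ 2) by (replace (E * N * s ^ 2) with (E * N * s * s) by ring; nra).
      apply Rabs_le_between. nra. }
    assert (H4 : Rabs (U * (E - EL)) <= E * N * s ^ 2 * B).
    { assert (HNs : 1 <= N * s ^ 2) by (clear - HN Hs; assert (1 <= s ^ 2) by nra; nra).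
      assert (E <= E * N * s ^ 2) by (clear - HE HNs; replace (E * N * s ^ 2) with (E * (N * s ^ 2)) by ring; nra).
      apply Rabs_le_between. nra. }
    apply Rabs_le_between in H3, H4. apply Rabs_le_between. unfold Z. nra. }
  apply Rle_trans with (B * Rabs Z).
  { eapply Rle_trans; [apply Rle_abs|]. rewrite Rabs_mult. pose proof (Rabs_pos Z). nra. }
  apply Rle_trans with (E * N * s ^ 2 * (B * (2 * l + 3 * B))); [nra|].
  apply Rle_trans with (E * N * s ^ 2 * (k * (4 * N * r2 - 2 * nn))).
  { apply Rmult_le_compat_l; lra. }
  replace (k * (E * N * (4 * N * q * s ^ 2 - 2 * nn * s))) with (E * N * (k * (4 * N * q * s ^ 2 - 2 * nn * s))) by ring.
  replace (E * N * s ^ 2 * (k * (4 * N * r2 - 2 * nn))) with (E * N * (k * (4 * N * r2 * s ^ 2 - 2 * nn * s ^ 2))) by ring.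
  assert (0 < E * N) by nra.
  apply Rmult_le_compat_l; [lra|]. apply Rmult_le_compat_l; [lra|].
  assert (N * r2 * s ^ 2 <= N * q * s ^ 2) by (apply Rmult_le_compat_r; [apply pow2_ge_0|apply Rmult_le_compat_l; lra]).
  assert (s <= s ^ 2) by (clear - Hs; nra).
  assert (nn * s <= nn * s ^ 2) by (apply Rmult_le_compat_l; lra). lra.
Qed.

Lemma deriv_pos_right (g : R -> R) (l : R) :
  derivable_pt_lim g 0 l -> 0 < l ->
  exists d, 0 < d /\ forall s, 0 < s < d -> g 0 + l / 2 * s <= g s.
Proof.
  intros Hg Hl. destruct (Hg (l / 2)) as [d Hd]; [lra|]. exists d. split; [apply cond_pos|].
  intros s Hs. specialize (Hd s ltac:(lra) ltac:(rewrite Rabs_pos_eq; lra)).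
  rewrite Rplus_0_l in Hd. apply Rabs_lt_between in Hd.
  assert (E : (g s - g 0) / s * s = g s - g 0) by (field; lra).
  assert (l / 2 * s <= (g s - g 0) / s * s) by (apply Rmult_le_compat_r; lra). lra.
Qed.

Lemma derivable_ray (g : R -> R) (x sg r l : R) :
  derivable_pt_lim g (x - sg * r) l -> derivable_pt_lim (fun r => g (x - sg * r)) r (l * - sg).
Proof.
  intros H. apply (derivable_pt_lim_comp (fun r => x - sg * r) g r (- sg) l); auto.
  apply is_derive_Reals. auto_derive; auto; ring.
Qed.

(** [F] is differentiable only inside [O]; the boundary condition on its gradient concerns the
    continuous extension [F1]. The mean value theorem is applied between two interior points of the
    ray, one close to [y], and continuity of [F] and [F1] up to [y] makes [F] of order [o (r)]. *)
Lemma ray_bound (n : nat) (O : pt -> Prop) (T : R) (F F1 : pt -> R -> R) (i : nat) (y : pt) (t sg d eta : R) :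
  is_open n O -> cont_on_K n O T F -> DX n O T i F F1 ->
  (i < n)%nat -> closure n O y -> 0 < t < T -> F y t = 0 -> F1 y t = 0 ->
  Rabs sg = 1 -> 0 < d -> (forall r, 0 < r < d -> O (upd y i (y i - sg * r))) -> 0 < eta ->
  exists d', 0 < d' /\ forall r, 0 < r < d' -> F (upd y i (y i - sg * r)) t <= eta * r.
Proof.
  intros HO HF [HF1 HFd] Hi Hy Ht HF0 HF10 Hsg Hd HOr Heta.
  assert (Hdist : forall r, 0 < r -> distn n y (upd y i (y i - sg * r)) = r).
  { intros r Hr. rewrite dist_upd by auto.
    replace (y i - sg * r - y i) with (- (sg * r)) by ring.
    rewrite Rabs_Ropp, Rabs_mult, Hsg, Rabs_pos_eq; lra. }
  assert (HK : forall r, 0 < r < d -> inK n O T (upd y i (y i - sg * r)) t).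
  { intros r Hr. split; [apply closure_incl; auto|lra]. }
  destruct (HF1 y t ltac:(split; auto; lra) eta Heta) as (d1 & Hd1 & H1).
  set (d' := Rmin d d1).
  assert (Hd' : 0 < d' /\ d' <= d /\ d' <= d1) by (unfold d', Rmin; destruct Rle_dec; lra).
  exists d'. split; [lra|]. intros r Hr. apply Rnot_lt_le; intros Hlt.
  set (g := fun r => F (upd y i (y i - sg * r)) t). fold (g r) in Hlt.
  destruct (HF y t ltac:(split; auto; lra) (g r - eta * r)) as (d2 & Hd2 & H2); [lra|].
  set (s := Rmin d2 r / 2).
  assert (Hs : 0 < s /\ s < d2 /\ s < r) by (unfold s, Rmin; destruct Rle_dec; lra).
  specialize (H2 (upd y i (y i - sg * s)) t ltac:(apply HK; lra)).
  rewrite Hdist, Rminus_diag, Rabs_R0, HF0, Rminus_0_r in H2 by lra.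
  specialize (H2 ltac:(lra) Hd2). fold (g s) in H2. apply Rabs_lt_between in H2.
  destruct (MVT_cor2 g (fun r => F1 (upd y i (y i - sg * r)) t * - sg) s r) as (c & Hc1 & Hc2); [lra| |].
  - intros c Hc. apply (derivable_ray (fun v => F (upd y i v) t)).
    apply (pd_upd i (fun z => F z t)). apply HFd; auto. apply HOr; lra.
  - specialize (H1 (upd y i (y i - sg * c)) t ltac:(apply HK; lra)).
    rewrite Hdist, Rminus_diag, Rabs_R0, HF10, Rminus_0_r in H1 by lra.
    specialize (H1 ltac:(lra) Hd1).
    set (G := F1 (upd y i (y i - sg * c)) t * - sg) in *.
    assert (HG : Rabs G < eta) by (unfold G; rewrite Rabs_mult, Rabs_Ropp, Hsg; lra).
    apply Rabs_lt_between in HG.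
    assert (G * (r - s) <= eta * (r - s)) by (apply Rmult_le_compat_r; lra).
    assert (0 < eta * s) by (apply Rmult_lt_0_compat; lra). lra.
Qed.

(** * The barrier, its derivatives, and contact with it *)

Lemma sqdist_upd (n : nat) (c x : pt) (i : nat) (s : R) :
  (i < n)%nat -> sqdist n c (upd x i s) = sqdist n c x + ((s - c i) ^ 2 - (x i - c i) ^ 2).
Proof.
  unfold sqdist. induction n as [|n IH]; intros Hi; [lia|]. cbn [sumR].
  destruct (Nat.eq_dec i n) as [->|Hn].
  - rewrite upd_same. rewrite (sumR_ext n _ (fun j => (x j - c j) ^ 2)); [ring|].
    intros j Hj. rewrite upd_other by lia. reflexivity.
  - rewrite IH, upd_other by lia. ring.
Qed.

Definition gaussian (n : nat) (x0 : pt) (N h : R) (x : pt) (t : R) : R :=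
  exp (- (N * (sqdist n x0 x - h)) / t).

Definition theta (c eps t : R) : R := exp (- c / (t + eps) ^ 2).

Definition layer (phi : pt -> R) (B eps : R) (x : pt) (t : R) : R := exp (phi x / (B * (t + eps))).

(** With [a = a0] and [a = 0] these are the two smooth branches of the positive part of the Gaussian
    profile minus [m] times the weight. *)
Definition barrier (n : nat) (x0 : pt) (phi : pt -> R) (a N h l m c B eps : R) (x : pt) (t : R) : R :=
  a * (gaussian n x0 N h x t - exp (- (N * l) / t)) - m * (theta c eps t * (2 - layer phi B eps x t)).

Definition barrier_d1 (n : nat) (x0 : pt) (phi : pt -> R) (P1 : nat -> pt -> R)
  (a N h m c B eps : R) (x : pt) (t : R) (i : nat) (s : R) : R :=
  let y := upd x i s in
  - (a * gaussian n x0 N h y t * (2 * N / t * (s - x0 i)))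
  + m * theta c eps t * (layer phi B eps y t * (P1 i y / (B * (t + eps)))).

Lemma barrier_dt (n : nat) (x0 : pt) (phi : pt -> R) (a N h l m c B eps : R) (x : pt) (t : R) :
  0 < t -> 0 < eps -> 0 < B ->
  derivable_pt_lim (fun s => barrier n x0 phi a N h l m c B eps x s) t
    (a * (gaussian n x0 N h x t * (N * (sqdist n x0 x - h)) / t ^ 2 - exp (- (N * l) / t) * (N * l) / t ^ 2)
     - m * theta c eps t * (2 * c / (t + eps) ^ 3 * (2 - layer phi B eps x t)
         + layer phi B eps x t * phi x / (B * (t + eps) ^ 2))).
Proof.
  intros Ht He HB. apply is_derive_Reals. unfold barrier, gaussian, theta, layer.
  auto_derive.
  - assert (0 < B * (t + eps)) by (apply Rmult_lt_0_compat; lra). repeat split; lra || nra.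
  - unfold Rdiv. simpl. rewrite !Rmult_1_r. field. lra.
Qed.

Lemma exp_deriv_comp (f : R -> R) (s l k : R) :
  derivable_pt_lim f s l -> derivable_pt_lim (fun r => exp (f r / k)) s (exp (f s / k) * (l / k)).
Proof.
  intros H. apply (derivable_pt_lim_comp (fun r => f r / k) exp s (l / k) (exp (f s / k))).
  - unfold Rdiv. rewrite Rmult_comm.
    replace (fun r => f r * / k) with (mult_real_fct (/ k) f).
    + now apply derivable_pt_lim_scal.
    + apply functional_extensionality; intros. unfold mult_real_fct. ring.
  - apply derivable_pt_lim_exp.
Qed.

Lemma gaussian_dx (n : nat) (x0 : pt) (N h : R) (x : pt) (t : R) (i : nat) (s : R) :
  (i < n)%nat -> 0 < t ->
  derivable_pt_lim (fun r => gaussian n x0 N h (upd x i r) t) s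
    (- (gaussian n x0 N h (upd x i s) t * (2 * N / t * (s - x0 i)))).
Proof.
  intros Hi Ht. unfold gaussian.
  replace (- (exp (- (N * (sqdist n x0 (upd x i s) - h)) / t) * (2 * N / t * (s - x0 i))))
    with (exp (- (N * (sqdist n x0 (upd x i s) - h)) / t) * (- (N * (2 * (s - x0 i))) / t))
    by (field; lra).
  apply (exp_deriv_comp (fun r => - (N * (sqdist n x0 (upd x i r) - h)))).
  apply is_derive_Reals.
  apply (is_derive_ext (fun r => - (N * (sqdist n x0 x + ((r - x0 i) ^ 2 - (x i - x0 i) ^ 2) - h)))).
  - intros r. now rewrite sqdist_upd.
  - auto_derive; auto. simpl. ring.
Qed.

Lemma barrier_dx (n : nat) (O : pt -> Prop) (x0 : pt) (phi : pt -> R) (P1 P2 : nat -> pt -> R)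
  (a N h l m c B eps : R) (x : pt) (t : R) (i : nat) (s : R) :
  defining_function n O phi P1 P2 -> (i < n)%nat -> inRn n x -> 0 < t ->
  derivable_pt_lim (fun r => barrier n x0 phi a N h l m c B eps (upd x i r) t) s
    (barrier_d1 n x0 phi P1 a N h m c B eps x t i s).
Proof.
  intros D Hi Hx Ht. unfold barrier, barrier_d1. cbv zeta.
  set (K := exp (- (N * l) / t)). set (th := theta c eps t).
  set (G := fun r => gaussian n x0 N h (upd x i r) t).
  set (X := fun r => layer phi B eps (upd x i r) t).
  assert (HG : is_derive G s (- (G s * (2 * N / t * (s - x0 i))))).
  { apply is_derive_Reals. now apply gaussian_dx. }
  assert (HX : is_derive X s (X s * (P1 i (upd x i s) / (B * (t + eps))))).
  { apply is_derive_Reals. apply (exp_deriv_comp (fun r => phi (upd x i r))).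
    apply (pd_upd i phi), (df_pd1 _ _ _ _ _ D); auto. now apply inRn_upd. }
  apply is_derive_Reals.
  apply (is_derive_ext (fun r => a * (G r - K) - m * (th * (2 - X r)))); [reflexivity|].
  auto_derive.
  - repeat split; eexists; eassumption.
  - apply is_derive_unique in HG, HX. change (fun r : R => G r) with G. change (fun r : R => X r) with X.
    rewrite HG, HX. unfold G, X. ring.
Qed.

Lemma barrier_dxx (n : nat) (O : pt -> Prop) (x0 : pt) (phi : pt -> R) (P1 P2 : nat -> pt -> R)
  (a N h m c B eps : R) (x : pt) (t : R) (i : nat) :
  defining_function n O phi P1 P2 -> (i < n)%nat -> inRn n x -> 0 < t ->
  derivable_pt_lim (barrier_d1 n x0 phi P1 a N h m c B eps x t i) (x i)
    (a * (gaussian n x0 N h x t * (4 * N ^ 2 / t ^ 2 * (x i - x0 i) ^ 2 + - (2 * N / t)))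
     + m * theta c eps t * (layer phi B eps x t *
         (/ (B * (t + eps)) ^ 2 * P1 i x ^ 2 + / (B * (t + eps)) * P2 i x))).
Proof.
  intros D Hi Hx Ht. unfold barrier_d1. cbv zeta.
  set (th := theta c eps t). set (k := B * (t + eps)).
  set (G := fun r => gaussian n x0 N h (upd x i r) t).
  set (X := fun r => layer phi B eps (upd x i r) t).
  set (Q := fun r => P1 i (upd x i r)).
  assert (HG : is_derive G (x i) (- (G (x i) * (2 * N / t * (x i - x0 i))))).
  { apply is_derive_Reals. now apply gaussian_dx. }
  assert (HX : is_derive X (x i) (X (x i) * (Q (x i) / k))).
  { apply is_derive_Reals. apply (exp_deriv_comp (fun r => phi (upd x i r))).
    apply (pd_upd i phi), (df_pd1 _ _ _ _ _ D); auto. now apply inRn_upd. }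
  assert (HQ : is_derive Q (x i) (P2 i x)).
  { apply is_derive_Reals. now apply (df_pd2 _ _ _ _ _ D). }
  apply is_derive_Reals.
  apply (is_derive_ext (fun r => - (a * G r * (2 * N / t * (r - x0 i))) + m * th * (X r * (Q r * / k)))).
  { intros r. unfold G, X, Q, k, Rdiv. reflexivity. }
  auto_derive.
  - repeat split; eexists; eassumption.
  - apply is_derive_unique in HG, HX, HQ. change (fun r : R => G r) with G.
    change (fun r : R => X r) with X. change (fun r : R => Q r) with Q.
    rewrite HG, HX, HQ. unfold G, X, Q. rewrite upd_id. unfold Rdiv. rewrite <- !pow_inv. fold k. set (ik := / k). field. lra.
Qed.

Lemma sum_barrier_d1 (n : nat) (x0 : pt) (phi : pt -> R) (P1 : nat -> pt -> R)
  (a N h m c B eps : R) (x : pt) (t : R) (v : nat -> R) :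
  sumR n (fun i => v i * barrier_d1 n x0 phi P1 a N h m c B eps x t i (x i)) =
  - (a * gaussian n x0 N h x t * (2 * N / t) * sumR n (fun i => v i * (x i - x0 i)))
  + m * theta c eps t * (layer phi B eps x t * sumR n (fun i => v i * P1 i x) / (B * (t + eps))).
Proof.
  unfold barrier_d1. cbv zeta.
  transitivity (sumR n (fun i =>
     - (a * gaussian n x0 N h x t * (2 * N / t)) * (v i * (x i - x0 i))
     + m * theta c eps t * layer phi B eps x t / (B * (t + eps)) * (v i * P1 i x))).
  - apply sumR_ext. intros i Hi. rewrite upd_id. unfold Rdiv. ring.
  - rewrite sumR_plus, !sumR_scal. unfold Rdiv. ring.
Qed.

(** At an interior contact from below the first derivatives of [e] and the barrier agree and [e] has
    the larger Laplacian, so the differential inequality passes to the barrier, which violates it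
    strictly through the weight. The Gaussian estimate is asked only if [0 < a], since contact with
    the other branch can occur beyond the cut-off. *)
Lemma barrier_interior (n : nat) (O : pt -> Prop) (T : R) (x0 : pt) (phi : pt -> R)
  (P1 P2 : nat -> pt -> R) (a N h l m c B eps k : R) (e et : pt -> R -> R)
  (E1 E2 : nat -> pt -> R -> R) (rho U : R) (u : nat -> R) (y : pt) (s d : R) :
  is_open n O -> defining_function n O phi P1 P2 ->
  O y -> 0 < s < T -> 0 < eps -> 0 < B -> 0 < m -> 0 <= a ->
  DT n O T e et ->
  (forall i, (i < n)%nat -> DX n O T i e (E1 i) /\ DX n O T i (E1 i) (E2 i)) ->
  k * sumR n (fun j => E2 j y s) <= rho * (et y s + sumR n (fun j => u j * E1 j y s) + U * e y s) ->
  0 < k ->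
  e y s = barrier n x0 phi a N h l m c B eps y s ->
  0 < d ->
  (forall r, Rabs (r - s) < d -> barrier n x0 phi a N h l m c B eps y r <= e y r) ->
  (forall i r, (i < n)%nat -> Rabs (r - y i) < d ->
     barrier n x0 phi a N h l m c B eps (upd y i r) s <= e (upd y i r) s) ->
  (let X := exp (phi y / (B * (s + eps))) in
   0 < rho * (2 * c / (s + eps) ^ 3 * (2 - X) + X * phi y / (B * (s + eps) ^ 2)
         - X * sumR n (fun j => u j * P1 j y) / (B * (s + eps)) + U * (2 - X))
      + k * (X * (sumR n (fun j => P1 j y ^ 2) / (B * (s + eps)) ^ 2
                  + sumR n (fun j => P2 j y) / (B * (s + eps))))) ->
  (0 < a -> let E := exp (- (N * (sqdist n x0 y - h)) / s) in let EL := exp (- (N * l) / s) in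
   rho * (E * (N * (sqdist n x0 y - h)) / s ^ 2 - EL * (N * l) / s ^ 2
          - E * (2 * N / s) * sumR n (fun j => u j * (y j - x0 j)) + U * (E - EL))
   <= k * (E * (4 * N ^ 2 * sqdist n x0 y / s ^ 2 - 2 * INR n * N / s))) ->
  False.
Proof.
  intros HO D Hy Hs Heps HB Hm Ha Het HE Hpde Hk Heq Hd Hmt Hmx Hw Hg.
  assert (Hin : inRn n y) by now apply HO.
  set (D1 := barrier_d1 n x0 phi P1 a N h m c B eps y s).
  destruct (touch_min n O T e et E1 E2 (barrier n x0 phi a N h l m c B eps) y s d
    (a * (gaussian n x0 N h y s * (N * (sqdist n x0 y - h)) / s ^ 2 - exp (- (N * l) / s) * (N * l) / s ^ 2)
     - m * theta c eps s * (2 * c / (s + eps) ^ 3 * (2 - layer phi B eps y s)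
         + layer phi B eps y s * phi y / (B * (s + eps) ^ 2))) D1
    (fun i => a * (gaussian n x0 N h y s * (4 * N ^ 2 / s ^ 2 * (y i - x0 i) ^ 2 + - (2 * N / s)))
     + m * theta c eps s * (layer phi B eps y s *
         (/ (B * (s + eps)) ^ 2 * P1 i y ^ 2 + / (B * (s + eps)) * P2 i y)))) as [Ht HX]; auto.
  - apply barrier_dt; lra.
  - intros i r Hi _. eapply barrier_dx; eauto; lra.
  - intros i Hi. eapply barrier_dxx; eauto; lra.
  - intros r Hr. specialize (Hmt r Hr). lra.
  - intros i r Hi Hr. specialize (Hmx i r Hi Hr). lra.
  - assert (S1 : sumR n (fun j => u j * E1 j y s) = sumR n (fun j => u j * D1 j (y j))).
    { apply sumR_ext. intros j Hj. now rewrite (proj1 (HX j Hj)). }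
    unfold D1 in S1. rewrite sum_barrier_d1 in S1.
    assert (S2 := sumR_le n _ _ (fun j Hj => proj2 (HX j Hj))).
    rewrite sumR_plus, !sumR_scal, sumR_plus, sumR_scal, sumR_const, !sumR_plus, !sumR_scal in S2.
    fold (sqdist n x0 y) in S2.
    rewrite S1, Ht, Heq in Hpde. unfold barrier in Hpde.
    fold (gaussian n x0 N h y s) in Hg. fold (layer phi B eps y s) in Hw. cbv zeta in Hg, Hw.
    set (E := gaussian n x0 N h y s) in *. set (EL := exp (- (N * l) / s)) in *.
    set (X := layer phi B eps y s) in *. set (th := theta c eps s) in *.
    assert (Hth : 0 < th) by apply exp_pos.
    set (q := sqdist n x0 y) in *. set (up := sumR n (fun j => u j * P1 j y)) in *.
    set (uq := sumR n (fun j => u j * (y j - x0 j))) in *.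
    set (A1 := sumR n (fun j => P1 j y ^ 2)) in *. set (A2 := sumR n (fun j => P2 j y)) in *.
    set (VV := E * (N * (q - h)) / s ^ 2 - EL * (N * l) / s ^ 2 - E * (2 * N / s) * uq + U * (E - EL)) in *.
    set (WW := 2 * c / (s + eps) ^ 3 * (2 - X) + X * phi y / (B * (s + eps) ^ 2)
         - X * up / (B * (s + eps)) + U * (2 - X)) in *.
    set (LV := E * (4 * N ^ 2 * q / s ^ 2 - 2 * INR n * N / s)) in *.
    set (LW := X * (A1 / (B * (s + eps)) ^ 2 + A2 / (B * (s + eps)))) in *.
    assert (Hrhs : rho * (a * VV - m * th * WW) =
      rho * (a * (E * (N * (q - h)) / s ^ 2 - EL * (N * l) / s ^ 2)
        - m * th * (2 * c / (s + eps) ^ 3 * (2 - X) + X * phi y / (B * (s + eps) ^ 2))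
        + (- (a * E * (2 * N / s) * uq) + m * th * (X * up / (B * (s + eps))))
        + U * (a * (E - EL) - m * (th * (2 - X))))) by (unfold VV, WW; ring).
    rewrite <- Hrhs in Hpde.
    assert (Hlhs : a * LV + m * th * LW <= sumR n (fun j => E2 j y s)).
    { eapply Rle_trans; [right|exact S2]. unfold LV, LW, Rdiv. ring. }
    apply (Rmult_le_compat_l k) in Hlhs; [|lra].
    (* The Gaussian and weight contributions separate: the first is nonnegative by [Hg], the second
       positive by [Hw]. *)
    assert (Hsum : a * (k * LV - rho * VV) + m * th * (rho * WW + k * LW) <= 0) by lra.
    assert (0 < m * th * (rho * WW + k * LW)).
    { apply Rmult_lt_0_compat; [now apply Rmult_lt_0_compat|exact Hw]. }
    assert (0 <= a * (k * LV - rho * VV)); [|lra].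
    destruct Ha as [Ha|<-]; [|lra]. specialize (Hg Ha). apply Rmult_le_pos; lra.
Qed.

(* [F] vanishes to first order at [y], so a barrier touching it from below there cannot increase
   along any coordinate direction entering [O]. *)
Lemma touch_boundary (n : nat) (O : pt -> Prop) (phi : pt -> R) (P1 P2 : nat -> pt -> R) (T : R)
  (F : pt -> R -> R) (F1 : nat -> pt -> R -> R) (Phi : pt -> R) (D : nat -> R) (y : pt) (t : R) :
  is_open n O -> defining_function n O phi P1 P2 -> boundary n O y -> 0 < t < T ->
  cont_on_K n O T F -> (forall i, (i < n)%nat -> DX n O T i F (F1 i)) ->
  F y t = 0 -> (forall i, (i < n)%nat -> F1 i y t = 0) -> Phi y = 0 ->
  (forall i, (i < n)%nat -> pd i Phi y (D i)) ->
  (exists d, 0 < d /\ forall i r, (i < n)%nat -> Rabs (r - y i) < d ->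
     O (upd y i r) -> Phi (upd y i r) <= F (upd y i r) t) ->
  0 <= sumR n (fun i => P1 i y * D i).
Proof.
  intros HO Df Hy Ht HF HF1 HF0 HF10 HPhi HD (d & Hd & Hle).
  apply Rnot_lt_le; intros Hneg.
  destruct (sumR_pos_term n (fun i => - (P1 i y * D i))) as (i & Hi & Hpos).
  { replace (sumR n (fun i => - (P1 i y * D i))) with (- sumR n (fun i => P1 i y * D i)); [lra|].
    replace (- sumR n (fun i => P1 i y * D i)) with (- 1 * sumR n (fun i => P1 i y * D i)) by ring.
    rewrite <- sumR_scal. apply sumR_ext; intros; ring. }
  assert (Hin : inRn n y) by apply Hy.
  (* Some axis has [P1 i y * D i < 0]; moving along it against the sign of [P1 i y] enters [O] and
     increases [Phi]. *)
  assert (Hsg : exists sg, Rabs sg = 1 /\ 0 < sg * P1 i y /\ 0 < - (sg * D i)).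
  { destruct (Rlt_le_dec 0 (P1 i y)) as [H|H].
    - exists 1. rewrite Rabs_R1. repeat split; nra.
    - exists (- (1)). rewrite Rabs_Ropp, Rabs_R1.
      assert (P1 i y < 0) by (destruct H as [H|E]; [auto|rewrite E in Hpos; lra]).
      repeat split; nra. }
  destruct Hsg as (sg & Hsg1 & HsgP & HsgD).
  assert (Hphi0 : phi y = 0).
  { apply Rle_antisym; [eapply closure_phi_le; eauto; apply Hy|].
    eapply boundary_iff; eauto. apply Hy. }
  assert (Hray : forall f l, pd i f y l -> derivable_pt_lim (fun r => f (upd y i (y i - sg * r))) 0 (l * - sg)).
  { intros f l Hf. apply (derivable_ray (fun v => f (upd y i v))). rewrite Rmult_0_r, Rminus_0_r. exact Hf. }
  assert (E0 : upd y i (y i - sg * 0) = y) by (rewrite Rmult_0_r, Rminus_0_r; apply upd_id).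
  destruct (deriv_pos_right (fun r => - phi (upd y i (y i - sg * r))) (- (P1 i y * - sg)))
    as (d1 & Hd1 & H1).
  { apply (derivable_pt_lim_opp (fun r => phi (upd y i (y i - sg * r)))).
    apply Hray, (df_pd1 _ _ _ _ _ Df); auto. }
  { lra. }
  destruct (deriv_pos_right (fun r => Phi (upd y i (y i - sg * r))) (D i * - sg)) as (d2 & Hd2 & H2).
  { apply Hray; auto. }
  { lra. }
  rewrite E0, Hphi0 in H1. rewrite E0, HPhi in H2.
  assert (HOr : forall r, 0 < r < d1 -> O (upd y i (y i - sg * r))).
  { intros r Hr. apply (df_neg _ _ _ _ _ Df); [now apply inRn_upd|].
    specialize (H1 r Hr). assert (0 < - (P1 i y * - sg) / 2 * r) by (apply Rmult_lt_0_compat; lra). lra. }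
  (* [Phi] grows along the ray at no less than half its slope; a quarter of the slope as bound for
     [F] gives the contradiction. *)
  destruct (ray_bound n O T F (F1 i) i y t sg d1 (D i * - sg / 4)) as (d3 & Hd3 & H3); auto.
  { apply Hy. }
  { lra. }
  set (r := Rmin (Rmin d d1) (Rmin d2 d3) / 2).
  assert (Hr : 0 < r /\ r < d /\ r < d1 /\ r < d2 /\ r < d3)
    by (unfold r, Rmin; repeat destruct Rle_dec; lra).
  specialize (H2 r ltac:(lra)). specialize (H3 r ltac:(lra)).
  specialize (Hle i (y i - sg * r) Hi).
  replace (y i - sg * r - y i) with (- (sg * r)) in Hle by ring.
  rewrite Rabs_Ropp, Rabs_mult, Hsg1, Rabs_pos_eq in Hle by lra.
  specialize (Hle ltac:(lra) ltac:(apply HOr; lra)).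
  assert (0 < D i * - sg / 4 * r) by (apply Rmult_lt_0_compat; lra). lra.
Qed.

(** * Comparison of [e] with the barrier *)

(** Only the exponential factor, set to 0 for [t <= 0]; for [a > 0] this is its limit as [t]
    decreases to 0. *)
Definition heat_kernel (a t : R) : R := if Rle_dec t 0 then 0 else exp (- a / t).

Lemma heat_kernel_pos (a t : R) : 0 < t -> heat_kernel a t = exp (- a / t).
Proof. intros Ht. unfold heat_kernel. destruct Rle_dec; [lra|reflexivity]. Qed.

Lemma heat_kernel_0 (a : R) : heat_kernel a 0 = 0.
Proof. unfold heat_kernel. destruct Rle_dec; [reflexivity|lra]. Qed.

Lemma heat_kernel_bounds (a t : R) : 0 <= a -> 0 <= heat_kernel a t <= 1.
Proof.
  intros Ha. unfold heat_kernel. destruct Rle_dec; [lra|]. split; [left; apply exp_pos|].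
  assert (0 <= a / t) by (apply Rdiv_le_0_compat; lra).
  unfold Rdiv. rewrite Ropp_mult_distr_l_reverse. fold (a / t). rewrite <- exp_0.
  destruct (Req_dec (a / t) 0) as [->|]; [rewrite Ropp_0; lra|]. left. apply exp_increasing. lra.
Qed.

(** At [t = 0] the uniform bound [a0 <= f] gives [exp (- f / t) <= t / a0]. At a positive limit time
    the sequence is shifted until all its times are positive. *)
Lemma seq_cont_heat_kernel (n : nat) (A : pt -> R -> Prop) (f : pt -> R -> R) (a0 : R) :
  0 < a0 -> (forall x t, A x t -> a0 <= f x t /\ 0 <= t) -> seq_cont n A f ->
  seq_cont n A (fun x t => heat_kernel (f x t) t).
Proof.
  intros Ha0 Hf Hc X tau x t HX Hx Hxc Ht.
  destruct (Hf x t Hx) as [Hfx [Ht0|Ht0]].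
  - rewrite heat_kernel_pos by auto.
    destruct (Ht t Ht0) as [N HN].
    assert (Hpos : forall k, 0 < tau (k + N)%nat).
    { intros k. specialize (HN (k + N)%nat ltac:(lia)). unfold Rdist in HN.
      apply Rabs_lt_between in HN. lra. }
    apply CV_shift with N.
    replace (fun k => heat_kernel (f (X (k + N)%nat) (tau (k + N)%nat)) (tau (k + N)%nat))
      with (fun k => (fun x t => exp (- f x t * / t)) (X (k + N)%nat) (tau (k + N)%nat)).
    2:{ apply functional_extensionality; intros k. now rewrite heat_kernel_pos. }
    set (A' := fun x t => A x t /\ 0 < t).
    assert (HA' : seq_cont n A' (fun x t => exp ((0 - f x t) * / t))).
    { apply (seq_cont_comp n A' exp (fun x t => (0 - f x t) * / t)); [intros; apply continuity_exp|].
      apply seq_cont_mult.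
      - apply seq_cont_minus; [apply seq_cont_const|].
        apply (seq_cont_sub n A); auto. intros z r [H _]; exact H.
      - apply seq_cont_inv; [intros z r [_ H]; lra|]. apply seq_cont_time. }
    assert (HA'' : seq_cont n A' (fun x t => exp (- f x t * / t))).
    { eapply seq_cont_ext; [|exact HA']. intros z r _. cbv beta. f_equal. ring. }
    apply (HA'' (fun k => X (k + N)%nat) (fun k => tau (k + N)%nat) x t).
    + intros k. split; auto.
    + split; auto.
    + intros j Hj. apply (CV_shift' (fun k => X k j)). now apply Hxc.
    + now apply (CV_shift' tau).
  - subst t. rewrite heat_kernel_0.
    intros eta Heta. destruct (Ht (a0 * eta)) as [N HN]; [apply Rmult_lt_0_compat; lra|].
    exists N. intros k Hk. specialize (HN k Hk). unfold Rdist in *. rewrite Rminus_0_r in *.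
    destruct (Hf _ _ (HX k)) as [Hfk Htk]. rewrite Rabs_pos_eq in HN by auto.
    destruct (heat_kernel_bounds (f (X k) (tau k)) (tau k)) as [Hb _]; [lra|].
    rewrite Rabs_pos_eq by auto.
    destruct Htk as [Htk|Htk]; [|rewrite <- Htk, heat_kernel_0; lra].
    rewrite heat_kernel_pos by auto.
    set (v := f (X k) (tau k)) in *. set (s := tau k) in *.
    pose proof (exp_ineq1_le (v / s)) as H1.
    assert (E : v / s * s = v) by (field; lra).
    assert (Hexp : exp (- v / s) * exp (v / s) = 1).
    { rewrite <- exp_plus. replace (- v / s + v / s) with 0 by (field; lra). apply exp_0. }
    pose proof (exp_pos (- v / s)) as Hp.
    assert (Hvs : 0 < v / s) by (apply Rdiv_lt_0_compat; lra).
    apply Rmult_lt_reg_r with (v / s); auto.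
    apply Rle_lt_trans with 1; [nra|].
    apply Rmult_lt_reg_r with s; auto. rewrite Rmult_1_l, Rmult_assoc, E. nra.
Qed.

Lemma seq_cont_weight (n : nat) (O : pt -> Prop) (phi : pt -> R) (T0 B c eps : R) :
  0 < B -> 0 < eps -> seq_cont n (inK n O T0) (fun x _ => phi x) ->
  seq_cont n (inK n O T0) (fun x t => theta c eps t * (2 - layer phi B eps x t)).
Proof.
  intros HB He Hphi.
  assert (Ht : seq_cont n (inK n O T0) (fun _ t => t + eps))
    by (apply seq_cont_plus; auto using seq_cont_time, seq_cont_const).
  apply seq_cont_mult.
  - apply (seq_cont_comp n _ exp (fun _ t => - c / (t + eps) ^ 2)); [intros; apply continuity_exp|].
    apply (seq_cont_mult n _ (fun _ _ => - c) (fun _ t => / (t + eps) ^ 2)); [apply seq_cont_const|].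
    apply (seq_cont_inv n _ (fun _ t => (t + eps) ^ 2)).
    + intros x t [_ H]. apply pow_nonzero. lra.
    + apply (seq_cont_ext n _ (fun _ t => (t + eps) * (t + eps))); [intros; ring|].
      now apply seq_cont_mult.
  - apply seq_cont_minus; [apply seq_cont_const|].
    apply (seq_cont_comp n _ exp (fun x t => phi x / (B * (t + eps)))); [intros; apply continuity_exp|].
    apply (seq_cont_mult n _ (fun x _ => phi x) (fun _ t => / (B * (t + eps)))); auto.
    apply (seq_cont_inv n _ (fun _ t => B * (t + eps))).
    + intros x t [_ H]. apply Rgt_not_eq, Rmult_lt_0_compat; lra.
    + apply seq_cont_mult; auto using seq_cont_const.
Qed.

Lemma sqdist_upd_gt (n : nat) (c x : pt) (r2 : R) :
  r2 < sqdist n c x ->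
  exists d, 0 < d /\ forall i s, (i < n)%nat -> Rabs (s - x i) < d -> r2 < sqdist n c (upd x i s).
Proof.
  intros H. set (q := sqdist n c x) in *. assert (Hq : 0 <= q) by apply sqdist_nonneg.
  exists ((q - r2) / (q + 1)). split; [apply Rdiv_lt_0_compat; lra|].
  intros i s Hi Hs. rewrite sqdist_upd by auto. fold q.
  assert (Hxi := sumR_term_le n (fun j => (x j - c j) ^ 2) i (fun j _ => pow2_ge_0 _) Hi).
  cbv beta in Hxi. change (sumR n (fun j => (x j - c j) ^ 2)) with q in Hxi.
  set (v := x i - c i) in *. set (w := s - x i) in *.
  replace ((s - c i) ^ 2 - v ^ 2) with (w ^ 2 + 2 * w * v) by (unfold w, v; ring).
  assert (E : (q - r2) / (q + 1) * (q + 1) = q - r2) by (field; lra).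
  assert (Hv : Rabs (2 * v) <= q + 1) by (apply Rabs_le_between; pose proof (pow2_ge_0 (v - 1)); pose proof (pow2_ge_0 (v + 1)); simpl in *; lra).
  assert (Hwv : Rabs (w * (2 * v)) <= Rabs w * (q + 1)).
  { rewrite Rabs_mult. apply Rmult_le_compat_l; auto using Rabs_pos. }
  assert (Rabs w * (q + 1) < (q - r2) / (q + 1) * (q + 1)) by (apply Rmult_lt_compat_r; lra).
  apply Rabs_le_between in Hwv. pose proof (pow2_ge_0 w). lra.
Qed.

(** If the bound fails, the least [m] for which [vp - m * wt] stays below [e] exceeds [M]. The
    contact point is then impossible everywhere: at time 0 by the initial sign, at [T0] by the size
    of [M], in the ball around [x0] because [vp <= a0 <= e], inside [O] by [barrier_interior], and
    on the boundary by [touch_boundary]. *)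
Lemma comparison (n : nat) (O : pt -> Prop) (phi : pt -> R) (P1 P2 : nat -> pt -> R)
  (T T0 : R) (x0 : pt) (k B eta rm c a0 h r2 l N dl : R)
  (rho e et U : pt -> R -> R) (u E1 E2 : nat -> pt -> R -> R) :
  (1 <= n)%nat -> is_open n O -> is_bounded n O -> defining_function n O phi P1 P2 ->
  0 < T0 < T ->
  cont_on_K n O T e -> DT n O T e et ->
  (forall i, (i < n)%nat -> DX n O T i e (E1 i) /\ DX n O T i (E1 i) (E2 i)) ->
  (forall x t, O x -> 0 < t <= T0 ->
     k * sumR n (fun j => E2 j x t) <=
     rho x t * (et x t + sumR n (fun j => u j x t * E1 j x t) + U x t * e x t)) ->
  (forall x, closure n O x -> 0 <= e x 0) ->
  (forall x t, boundary n O x -> 0 < t <= T0 ->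
     e x t = 0 /\ forall i, (i < n)%nat -> E1 i x t = 0) ->
  0 < k -> 1 <= B -> 0 < eta -> 0 < rm -> c = k * eta / (60 * B ^ 3) ->
  2 * T0 <= 1 -> 4 * B * (2 * T0) ^ 2 <= c -> k * (2 * T0) ^ 2 < rm * c -> 2 * B ^ 2 * (2 * T0) <= eta ->
  (forall x t, O x -> 0 < t <= T0 ->
     Rabs (sumR n (fun j => u j x t * P1 j x)) <= B /\ Rabs (U x t) <= B /\
     Rabs (sumR n (fun j => u j x t * (x j - x0 j))) <= B /\ Rabs (rho x t) <= B /\
     (phi x <= - eta -> rm <= rho x t) /\ - B * t <= rho x t /\ (phi x <= - B * t -> 0 <= rho x t)) ->
  (forall x, closure n O x -> - B <= sumR n (fun j => P2 j x) /\ sumR n (fun j => P1 j x ^ 2) <= B /\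
     (- eta <= phi x -> eta <= sumR n (fun j => P1 j x ^ 2))) ->
  (forall x t, inK n O T0 x t -> - B <= e x t) ->
  0 < a0 -> (forall x t, inK n O T0 x t -> sqdist n x0 x <= r2 -> a0 <= e x t) ->
  0 < h < r2 -> 0 < l -> 1 <= N -> B * (2 * l + 3 * B) <= k * (4 * N * r2 - 2 * INR n) ->
  1 <= N * dl ->
  (forall y, boundary n O y -> sqdist n x0 y - h <= l -> dl <= sumR n (fun j => P1 j y * (y j - x0 j))) ->
  forall eps x t, 0 < eps <= T0 -> closure n O x -> 0 < t <= T0 -> r2 <= sqdist n x0 x ->
    a0 * (gaussian n x0 N h x t - exp (- (N * l) / t))
      - 2 * ((B + a0) * exp (c / T0 ^ 2)) * theta c eps t <= e x t.
Proof.
  intros Hn HO HOb D HT0 Hec Het HE Hpde He0 Hebd Hk HB Heta Hrm Hc Hs0 Hs1 Hs2 Hs3 Hbounds Hgeo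
    HeB Ha0 Hball Hh Hl HN HNbig HNdl Hvis eps x t Heps Hx Ht Hqx.
  set (M := (B + a0) * exp (c / T0 ^ 2)).
  assert (Hcp : 0 < c).
  { rewrite Hc. assert (0 < B ^ 3) by (apply pow_lt; lra).
    apply Rdiv_lt_0_compat; [apply Rmult_lt_0_compat|]; lra. }
  assert (HMp : 0 < M) by (apply Rmult_lt_0_compat; [lra|apply exp_pos]).
  (* Outside the ball this is the Gaussian profile. Inside, [Rmax] keeps the exponent away from 0,
     so that [v] is continuous down to [t = 0], where it vanishes. *)
  set (v := fun x t => a0 * (heat_kernel (Rmax (N * (r2 - h)) (N * (sqdist n x0 x - h))) t - heat_kernel (N * l) t)).
  set (vp := fun x t => Rmax 0 (v x t)).
  set (wt := fun x t => theta c eps t * (2 - layer phi B eps x t)).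
  set (A := inK n O T0).
  assert (HA : seq_compact n A) by (apply inK_compact; auto; lra).
  assert (Hclphi : forall z, closure n O z -> phi z <= 0) by (intros; eapply closure_phi_le; eauto).
  assert (Hlay : forall z r, A z r -> 0 < layer phi B eps z r <= 1).
  { intros z r [Hz Hr]. split; [apply exp_pos|]. unfold layer. rewrite <- exp_0.
    specialize (Hclphi z Hz).
    assert (Hd : 0 < B * (r + eps)) by (apply Rmult_lt_0_compat; lra).
    assert (Hdiv : phi z / (B * (r + eps)) <= 0) by (apply Rdiv_le_bound; lra).
    destruct Hdiv as [Hdiv| ->]; [left; now apply exp_increasing|lra]. }
  assert (Hth : forall r, 0 < theta c eps r) by (intros; apply exp_pos).
  assert (Hwt : forall z r, A z r -> theta c eps r <= wt z r <= 2 * theta c eps r).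
  { intros z r Hz. specialize (Hlay z r Hz). specialize (Hth r). unfold wt. nra. }
  assert (HNr : 0 < N * (r2 - h)) by (apply Rmult_lt_0_compat; lra).
  assert (Hvp : forall z r, 0 <= vp z r <= a0).
  { intros z r. unfold vp, v.
    destruct (heat_kernel_bounds (Rmax (N * (r2 - h)) (N * (sqdist n x0 z - h))) r) as [H1 H2].
    { eapply Rle_trans; [|apply Rmax_l]. lra. }
    destruct (heat_kernel_bounds (N * l) r) as [H3 H4]; [apply Rmult_le_pos; lra|].
    split; [apply Rmax_l|]. apply Rmax_lub; [lra|]. rewrite <- (Rmult_1_r a0) at 2.
    apply Rmult_le_compat_l; lra. }
  assert (Hvform : forall z r, 0 < r -> r2 <= sqdist n x0 z ->
            v z r = a0 * (gaussian n x0 N h z r - exp (- (N * l) / r))).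
  { intros z r Hr Hq. unfold v. rewrite !heat_kernel_pos by auto.
    rewrite Rmax_right by (apply Rmult_le_compat_l; lra). reflexivity. }
  assert (Hphic : seq_cont n A (fun z _ => phi z)).
  { apply cont_Rn_seq; [intros z r Hz; apply Hz|]. apply (df_cont _ _ _ _ _ D). }
  assert (Hwtp : forall z r, A z r -> 0 < wt z r).
  { intros z r Hz. specialize (Hwt z r Hz). specialize (Hth r). lra. }
  apply Rnot_lt_le; intros Hlt.
  set (f := fun z r => (e z r - vp z r) * / wt z r).
  destruct (compact_min n A f HA) as (y & s & Hy & Hmin).
  { apply seq_cont_mult.
    - apply seq_cont_minus.
      + apply (seq_cont_sub n (inK n O T)); [|now apply cont_on_K_seq].
        intros z r [Hz Hr]; split; auto; lra.
      + apply (seq_cont_Rmax n A 0 v). apply seq_cont_mult; [apply seq_cont_const|].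
        apply seq_cont_minus.
        * apply (seq_cont_heat_kernel n A (fun z _ => Rmax (N * (r2 - h)) (N * (sqdist n x0 z - h))) (N * (r2 - h))); auto.
          -- intros z r Hz. split; [apply Rmax_l|apply Hz].
          -- apply (seq_cont_Rmax n A (N * (r2 - h)) (fun z _ => N * (sqdist n x0 z - h))).
             apply seq_cont_mult; [apply seq_cont_const|].
             apply seq_cont_minus; auto using seq_cont_sqdist, seq_cont_const.
        * apply (seq_cont_heat_kernel n A (fun _ _ => N * l) (N * l)).
          -- apply Rmult_lt_0_compat; lra.
          -- intros z r Hz. split; [lra|apply Hz].
          -- apply seq_cont_const.
    - apply seq_cont_inv; [intros z r Hz; specialize (Hwtp z r Hz); lra|].
      apply seq_cont_weight; auto; lra. }
  { exists x, t. split; auto; lra. }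
  set (m := - f y s).
  assert (Hge : forall z r, A z r -> vp z r - m * wt z r <= e z r).
  { intros z r Hz. specialize (Hmin z r Hz). specialize (Hwtp z r Hz).
    assert (E : f z r * wt z r = e z r - vp z r) by (unfold f; field; lra).
    assert (- m * wt z r <= f z r * wt z r) by (apply Rmult_le_compat_r; unfold m; lra). lra. }
  assert (Heq : e y s = vp y s - m * wt y s).
  { specialize (Hwtp y s Hy). unfold m, f. field. lra. }
  assert (HmM : M < m).
  { assert (HxA : A x t) by (split; auto; lra).
    specialize (Hwt x t HxA). specialize (Hwtp x t HxA). pose proof (Hmin x t HxA) as Hm.
    rewrite <- Hvform in Hlt by lra.
    assert (v x t <= vp x t) by apply Rmax_r.
    assert (E : f x t * wt x t = e x t - vp x t) by (unfold f; field; lra).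
    assert (M * wt x t <= M * (2 * theta c eps t)) by (apply Rmult_le_compat_l; lra).
    assert (Hf : f x t * wt x t < - M * wt x t) by lra.
    apply Rmult_lt_reg_r in Hf; auto. unfold m. lra. }
  assert (Hmw : forall z r, A z r -> 0 < m * wt z r).
  { intros z r Hz. apply Rmult_lt_0_compat; [lra|auto]. }
  assert (Hneg : e y s < vp y s) by (specialize (Hmw y s Hy); lra).
  destruct Hy as [Hyc Hs].
  assert (Hs0' : 0 < s).
  { destruct (Req_dec s 0) as [->|]; [|lra]. exfalso. specialize (He0 y Hyc).
    unfold vp, v in Hneg. rewrite !heat_kernel_0, Rminus_diag, Rmult_0_r, Rmax_left in Hneg; lra. }
  assert (HyA : A y s) by (split; auto).
  (* At [T0] contact would give [e < a0 - (B + a0) = - B]. *)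
  assert (HsT : s < T0).
  { destruct (Req_dec s T0) as [->|]; [exfalso|lra].
    assert (H1 : exp (- (c / T0 ^ 2)) <= theta c eps T0).
    { unfold theta. assert (H2 : / (T0 + eps) ^ 2 <= / T0 ^ 2).
      { apply Rinv_le_contravar; [apply pow_lt; lra|]. apply pow_incr. lra. }
      assert (H3 : - (c / T0 ^ 2) <= - c / (T0 + eps) ^ 2).
      { unfold Rdiv. rewrite <- Ropp_mult_distr_l. apply Ropp_le_contravar, Rmult_le_compat_l; lra. }
      destruct H3 as [H3| ->]; [left; now apply exp_increasing|lra]. }
    assert (H2 : M * exp (- (c / T0 ^ 2)) = B + a0).
    { unfold M. rewrite Rmult_assoc, <- exp_plus, Rplus_opp_r, exp_0. ring. }
    specialize (HeB y T0 HyA). specialize (Hvp y T0). specialize (Hwt y T0 HyA).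
    assert (M * exp (- (c / T0 ^ 2)) < m * wt y T0); [|lra].
    pose proof (exp_pos (- (c / T0 ^ 2))).
    apply Rlt_le_trans with (m * exp (- (c / T0 ^ 2))).
    - apply Rmult_lt_compat_r; lra.
    - apply Rmult_le_compat_l; lra. }
  assert (Hqy : r2 < sqdist n x0 y).
  { apply Rnot_le_lt; intros Hq. specialize (Hball y s HyA Hq). specialize (Hvp y s). lra. }
  assert (Hvl : 0 < v y s -> sqdist n x0 y - h < l).
  { intros Hv. rewrite Hvform in Hv by lra.
    assert (H1 : exp (- (N * l) / s) < exp (- (N * (sqdist n x0 y - h)) / s)) by (unfold gaussian in Hv; nra).
    apply exp_lt_inv in H1.
    assert (H2 : - (N * l) / s * s < - (N * (sqdist n x0 y - h)) / s * s) by (apply Rmult_lt_compat_r; lra).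
    unfold Rdiv in H2. rewrite !Rmult_assoc, Rinv_l, !Rmult_1_r in H2 by lra.
    apply Rmult_lt_reg_l with N; lra. }
  assert (Hbar : forall a z r, a = 0 \/ a = a0 -> A z r -> 0 < r -> r2 <= sqdist n x0 z ->
            barrier n x0 phi a N h l m c B eps z r <= e z r).
  { intros a z r Ha Hz Hr Hq. specialize (Hge z r Hz). unfold barrier. fold (wt z r).
    assert (H0 : 0 <= vp z r) by apply Rmax_l.
    assert (H1 : v z r <= vp z r) by apply Rmax_r. rewrite Hvform in H1 by auto.
    destruct Ha as [-> | ->]; lra. }
  destruct (classic (O y)) as [HyO|HyO].
  (* The branch of [vp] that is active at the contact point; the Gaussian one is active only within
     the cut-off [q - h < l]. *)
  - assert (Ha : exists a, (a = 0 \/ a = a0) /\ e y s = barrier n x0 phi a N h l m c B eps y s /\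
                   (0 < a -> sqdist n x0 y - h < l)).
    { destruct (Rlt_le_dec 0 (v y s)) as [Hv|Hv].
      - exists a0. split; [auto|]. split; [|auto]. unfold barrier. fold (wt y s).
        rewrite <- Hvform by lra. unfold vp in Heq. rewrite Rmax_right in Heq by lra. exact Heq.
      - exists 0. split; [auto|]. split; [|lra]. unfold barrier. fold (wt y s).
        unfold vp in Heq. rewrite Rmax_left in Heq by lra. lra. }
    destruct Ha as (a & Ha & Heqa & Hal).
    destruct (open_coord n O y HO HyO) as (d1 & Hd1 & HO1).
    destruct (sqdist_upd_gt n x0 y r2 Hqy) as (d2 & Hd2 & Hq2).
    set (d := Rmin (Rmin d1 d2) (Rmin s (T0 - s))).
    assert (Hd : 0 < d /\ d <= d1 /\ d <= d2 /\ d <= s /\ d <= T0 - s)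
      by (unfold d, Rmin; repeat destruct Rle_dec; lra).
    destruct (Hbounds y s HyO ltac:(lra)) as (Hb1 & Hb2 & Hb3 & Hb4 & Hb5 & Hb6 & Hb7).
    destruct (Hgeo y Hyc) as (Hg1 & Hg2 & Hg3).
    apply (barrier_interior n O T x0 phi P1 P2 a N h l m c B eps k e et E1 E2
             (rho y s) (U y s) (fun j => u j y s) y s d); auto; try lra.
    + apply Hpde; auto; lra.
    + intros r Hr. apply Rabs_lt_between in Hr. apply Hbar; auto; try lra. split; auto; lra.
    + intros i r Hi Hr. apply Hbar; auto; try lra.
      * split; [apply closure_incl; auto; apply HO1; auto; lra|lra].
      * left. apply Hq2; auto; lra.
    + assert (H2T : s + eps <= 2 * T0) by lra.
      assert (Hsq : (s + eps) ^ 2 <= (2 * T0) ^ 2) by (apply pow_incr; lra).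
      apply weight_super with (eta := eta) (rm := rm) (t := s); auto; try lra.
      * eapply Rle_trans; [|exact Hs1]. apply Rmult_le_compat_l; lra.
      * eapply Rle_lt_trans; [|exact Hs2]. apply Rmult_le_compat_l; lra.
      * eapply Rle_trans; [|exact Hs3]. apply Rmult_le_compat_l; [|lra].
        pose proof (pow2_ge_0 B); lra.
      * apply sumR_nonneg; intros; apply pow2_ge_0.
    + intros Hap. specialize (Hal Hap).
      apply (gaussian_sub k B N (INR n) (h) r2 l); auto; try lra.
      apply pos_INR.
  - assert (Hyb : boundary n O y) by (split; auto).
    destruct (Hebd y s Hyb ltac:(lra)) as [He00 HE00].
    specialize (Hmw y s HyA) as Hmwy.
    (* Otherwise [e] would equal [- m * wt < 0] at a boundary point, where it vanishes. With [v > 0]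
       the point lies within the cut-off, so it is visible from [x0]. *)
    assert (Hv : 0 < v y s).
    { apply Rnot_le_lt; intros Hv. unfold vp in Heq. rewrite Rmax_left in Heq by lra. lra. }
    assert (Evp : vp y s = v y s) by (unfold vp; apply Rmax_right; lra).
    specialize (Hvis y Hyb ltac:(specialize (Hvl Hv); lra)).
    destruct (sqdist_upd_gt n x0 y r2 Hqy) as (d2 & Hd2 & Hq2).
    assert (Hiny : inRn n y) by apply Hyc.
    assert (Hsum : 0 <= sumR n (fun i => P1 i y * barrier_d1 n x0 phi P1 a0 N h m c B eps y s i (y i))).
    { apply (touch_boundary n O phi P1 P2 T e E1 (fun z => barrier n x0 phi a0 N h l m c B eps z s) _ y s);
        auto; try lra.
      - intros i Hi. now apply HE.
      - unfold barrier. fold (wt y s). rewrite <- Hvform by lra. lra.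
      - intros i Hi. unfold pd. eapply barrier_dx; eauto.
      - exists d2. split; auto. intros i r Hi Hr HOr. apply Hbar; auto.
        + split; [now apply closure_incl|lra].
        + left. apply Hq2; auto. }
    rewrite sum_barrier_d1 in Hsum.
    set (F := sumR n (fun i => P1 i y * (y i - x0 i))) in *.
    replace (sumR n (fun i => P1 i y * P1 i y)) with (sumR n (fun i => P1 i y ^ 2)) in Hsum
      by (apply sumR_ext; intros; ring).
    set (A1 := sumR n (fun i => P1 i y ^ 2)) in *.
    assert (HA1 : 0 <= A1 <= B).
    { split; [apply sumR_nonneg; intros; apply pow2_ge_0|now apply Hgeo]. }
    rewrite Evp, Hvform in Heq by lra. rewrite He00 in Heq.
    set (G := gaussian n x0 N h y s) in *.
    assert (HG : 0 < G) by apply exp_pos.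
    pose proof (exp_pos (- (N * l) / s)) as HEL.
    (* Since [e = 0] here, the weight part equals the Gaussian part, so its coefficient is
       controlled. Along [P1] the weight raises the barrier by at most [a0 * G / s], while the
       Gaussian lowers it by at least [2 * a0 * G / s], owing to [1 <= N * dl]. *)
    assert (Hmth : m * theta c eps s <= a0 * G).
    { apply Rle_trans with (m * wt y s).
      - apply Rmult_le_compat_l; [lra|]. now apply Hwt.
      - assert (0 < a0 * exp (- (N * l) / s)) by (apply Rmult_lt_0_compat; lra). lra. }
    specialize (Hlay y s HyA). set (X := layer phi B eps y s) in *.
    assert (H1 : X * A1 / (B * (s + eps)) <= / s).
    { assert (0 < B * (s + eps)) by (apply Rmult_lt_0_compat; lra).
      apply Rdiv_le_bound; auto.
      apply Rle_trans with (1 * B); [apply Rmult_le_compat; lra|].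
      replace (/ s * (B * (s + eps))) with (B * 1 + B * eps * / s) by (field; lra).
      assert (0 < B * eps * / s) by (repeat apply Rmult_lt_0_compat; try lra; now apply Rinv_0_lt_compat).
      lra. }
    assert (Hinv : 0 < / s) by now apply Rinv_0_lt_compat.
    assert (H2 : m * theta c eps s * (X * A1 / (B * (s + eps))) <= a0 * G * / s).
    { specialize (Hth s). apply Rmult_le_compat; auto.
      - apply Rmult_le_pos; lra.
      - apply Rdiv_le_0_compat; [apply Rmult_le_pos; lra|apply Rmult_lt_0_compat; lra]. }
    assert (H3 : a0 * G * / s * 2 <= a0 * G * (2 * N / s) * F).
    { replace (a0 * G * (2 * N / s) * F) with (a0 * G * / s * (2 * (N * F))) by (field; lra).
      apply Rmult_le_compat_l.
      - left. repeat apply Rmult_lt_0_compat; lra.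
      - assert (N * dl <= N * F) by (apply Rmult_le_compat_l; lra). lra. }
    assert (0 < a0 * G * / s) by (repeat apply Rmult_lt_0_compat; lra).
    lra.
Qed.

(** In terms of [s = / t] this is a quadratic against a linear exponent. The time [t + t] is the
    shifted time for [eps = t]. *)
Lemma gaussian_beats_weight (a M c A1 A2 T0 : R) :
  0 < a -> 0 < M -> 0 < c -> 0 <= A1 < A2 -> 0 < T0 ->
  exists t, 0 < t <= T0 /\ M * exp (- c / (t + t) ^ 2) < a * (exp (- A1 / t) - exp (- A2 / t)).
Proof.
  intros Ha HM Hc HA HT.
  (* In order, the summands give [t <= T0], [exp (- ((A2 - A1) * s)) <= / 2],
     [(1 + A1) * s <= c / 4 * s ^ 2], and [M * exp (- s) < a / 2]. *)
  set (s := / T0 + / (A2 - A1) + 4 * (1 + A1) / c + 2 * M / a).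
  assert (H1 : 0 < / T0) by now apply Rinv_0_lt_compat.
  assert (H2 : 0 < / (A2 - A1)) by (apply Rinv_0_lt_compat; lra).
  assert (H3 : 0 < 4 * (1 + A1) / c) by (apply Rdiv_lt_0_compat; lra).
  assert (H4 : 0 < 2 * M / a) by (apply Rdiv_lt_0_compat; lra).
  assert (Hs : 0 < s) by (unfold s; lra).
  exists (/ s). split; [split|].
  - now apply Rinv_0_lt_compat.
  - rewrite <- (Rinv_inv T0). apply Rinv_le_contravar; auto. unfold s; lra.
  - replace (- c / (/ s + / s) ^ 2) with (- (c / 4 * s ^ 2)) by (field; lra).
    replace (- A1 / / s) with (- (A1 * s)) by (field; lra).
    replace (- A2 / / s) with (- (A1 * s) + - ((A2 - A1) * s)) by (field; lra).
    rewrite exp_plus. set (E := exp (- (A1 * s))). assert (HE : 0 < E) by apply exp_pos.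
    assert (H5 : exp (- ((A2 - A1) * s)) <= / 2).
    { rewrite exp_Ropp. apply Rinv_le_contravar; [lra|].
      assert (E2 : (A2 - A1) * / (A2 - A1) = 1) by (field; lra).
      assert ((A2 - A1) * / (A2 - A1) <= (A2 - A1) * s) by (apply Rmult_le_compat_l; unfold s; lra).
      pose proof (exp_ineq1_le ((A2 - A1) * s)). lra. }
    assert (H6 : exp (- (c / 4 * s ^ 2)) <= E * exp (- s)).
    { unfold E. rewrite <- exp_plus.
      assert (H7 : (1 + A1) <= c / 4 * s).
      { assert (E3 : c / 4 * (4 * (1 + A1) / c) = 1 + A1) by (field; lra).
        rewrite <- E3. apply Rmult_le_compat_l; unfold s; lra. }
      assert (H8 : (1 + A1) * s <= c / 4 * s * s) by (apply Rmult_le_compat_r; lra).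
      assert (H9 : - (c / 4 * s ^ 2) <= - (A1 * s) + - s) by (simpl; lra).
      destruct H9 as [H9| ->]; [left; now apply exp_increasing|lra]. }
    assert (H7 : M * exp (- s) < a / 2).
    { rewrite exp_Ropp. pose proof (exp_ineq1_le s) as H8.
      assert (E4 : 2 * M / a * a = 2 * M) by (field; lra).
      assert (H9 : 2 * M < exp s * a).
      { rewrite <- E4. apply Rmult_lt_compat_r; [lra|]. unfold s in *; lra. }
      apply Rmult_lt_reg_r with (exp s); [apply exp_pos|].
      rewrite Rmult_assoc, Rinv_l; [lra|]. apply Rgt_not_eq, exp_pos. }
    apply Rle_lt_trans with (E * (M * exp (- s))).
    { replace (E * (M * exp (- s))) with (M * (E * exp (- s))) by ring. apply Rmult_le_compat_l; lra. }
    apply Rlt_le_trans with (E * (a / 2)); [now apply Rmult_lt_compat_l|].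
    assert (a * (E * exp (- ((A2 - A1) * s))) <= a * (E * / 2)).
    { apply Rmult_le_compat_l; [lra|]. apply Rmult_le_compat_l; lra. }
    lra.
Qed.

(** * Nonexistence *)

Lemma exists_small (a b c d e f : R) :
  0 < a -> 0 < b -> 0 < c -> 0 < d -> 0 < e -> 0 < f ->
  exists x, 0 < x /\ x <= a /\ x <= b /\ x <= c /\ x <= d /\ x <= e /\ x <= f.
Proof.
  intros. exists (Rmin (Rmin a (Rmin b c)) (Rmin d (Rmin e f))).
  unfold Rmin; repeat destruct Rle_dec; lra.
Qed.

(** The fluid system enters only through transport of [rho] and one differential inequality for [e].
    What remains is to fix the constants: [B] and [c] come from the whole interval [[0, T]], and
    only then is [T0] made small. *)
Lemma no_supersolution (n : nat) (O : pt -> Prop) (phi : pt -> R) (P1 P2 : nat -> pt -> R)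
  (T k : R) (rho Rt divu U e et : pt -> R -> R) (R1 u E1 E2 : nat -> pt -> R -> R) :
  (1 <= n)%nat -> is_open n O -> is_bounded n O -> defining_function n O phi P1 P2 ->
  0 < T -> 0 < k ->
  cont_on_K n O T rho -> DT n O T rho Rt -> (forall j, (j < n)%nat -> DX n O T j rho (R1 j)) ->
  (forall j, (j < n)%nat -> cont_on_K n O T (u j)) ->
  seq_cont n (inK n O T) divu -> seq_cont n (inK n O T) U ->
  cont_on_K n O T e -> DT n O T e et ->
  (forall i, (i < n)%nat -> DX n O T i e (E1 i) /\ DX n O T i (E1 i) (E2 i)) ->
  (forall x t, O x -> 0 < t < T ->
     Rt x t + sumR n (fun j => R1 j x t * u j x t) + rho x t * divu x t = 0) ->
  (forall x t, O x -> 0 < t < T ->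
     k * sumR n (fun j => E2 j x t) <=
     rho x t * (et x t + sumR n (fun j => u j x t * E1 j x t) + U x t * e x t)) ->
  (forall x, O x -> 0 < rho x 0) ->
  (forall x, O x -> 0 <= e x 0) -> (exists x, O x /\ 0 < e x 0) ->
  (forall x t, boundary n O x -> 0 < t <= T -> e x t = 0 /\ forall i, (i < n)%nat -> E1 i x t = 0) ->
  False.
Proof.
  intros Hn HO HOb D HT Hk Hrc Hrt Hr1 Huc Hdc HUc Hec Het HE Htr Hheat Hr0 He0 (x0 & Hx0 & He00) Hbd.
  set (A := inK n O T). assert (HA : seq_compact n A) by (apply inK_compact; auto; lra).
  assert (HinR : forall x t, A x t -> inRn n x) by (intros x t Hx; apply Hx).
  assert (Hcl : forall x, O x -> closure n O x) by (intros; now apply closure_incl).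
  assert (Hphic : forall A', (forall x t, A' x t -> inRn n x) -> seq_cont n A' (fun x _ => phi x))
    by (intros; apply cont_Rn_seq; auto; apply (df_cont _ _ _ _ _ D)).
  assert (HP1c : forall j, (j < n)%nat -> seq_cont n A (fun x _ => P1 j x))
    by (intros; apply cont_Rn_seq; auto; intros; now apply (df_cont1 _ _ _ _ _ D)).
  assert (Hu : forall j, (j < n)%nat -> seq_cont n A (u j)) by (intros; apply cont_on_K_seq; auto).
  destruct (compact_bounded n A rho HA) as (B1 & HB1p & HB1); [now apply cont_on_K_seq|].
  destruct (compact_bounded n A Rt HA) as (B2 & HB2p & HB2); [apply cont_on_K_seq, Hrt|].
  destruct (compact_bounded n A (fun x t => sumR n (fun j => u j x t * P1 j x)) HA) as (B3 & HB3p & HB3).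
  { apply (seq_cont_sum n n A (fun j x t => u j x t * P1 j x)). intros j Hj. now apply seq_cont_mult; auto. }
  destruct (compact_bounded n A divu HA Hdc) as (B4 & HB4p & HB4).
  destruct (compact_bounded n A (fun x _ => phi x) HA (Hphic A HinR)) as (B5 & HB5p & HB5).
  destruct (compact_bounded n A U HA HUc) as (B6 & HB6p & HB6).
  destruct (compact_bounded n A (fun x _ => sumR n (fun j => P2 j x)) HA) as (B7 & HB7p & HB7).
  { apply (seq_cont_sum n n A (fun j x _ => P2 j x)). intros j Hj.
    apply cont_Rn_seq; auto. intros; now apply (df_cont2 _ _ _ _ _ D). }
  destruct (compact_bounded n A (fun x t => sumR n (fun j => u j x t * (x j - x0 j))) HA) as (B8 & HB8p & HB8).
  { apply (seq_cont_sum n n A (fun j x t => u j x t * (x j - x0 j))). intros j Hj.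
    apply seq_cont_mult; auto. apply seq_cont_minus; auto using seq_cont_coord, seq_cont_const. }
  destruct (compact_bounded n A e HA) as (B9 & HB9p & HB9); [now apply cont_on_K_seq|].
  destruct (compact_bounded n A (fun x _ => sumR n (fun i => P1 i x ^ 2)) HA) as (B10 & HB10p & HB10).
  { eapply seq_cont_grad_sq; eauto. }
  set (b := B3 + B4 + B5).
  assert (Hb2 : 0 <= b ^ 2) by apply pow2_ge_0.
  (* [B] dominates all bounds and also the speed [1 + b + b ^ 2] of [density_nonneg], so that
     [rho >= 0] wherever [phi <= - B * t]. *)
  set (B := 1 + b + b ^ 2 + B1 + B2 + B6 + B7 + B8 + B9 + B10).
  destruct (grad_near_boundary n O phi P1 P2 Hn HO HOb D) as (eta & Heta & Hgrad).
  destruct (compact_uniform n (inK n O 0) (fun x _ => rho x 0) (fun x _ => phi x + eta)) as (rm2 & Hrm2 & Hrm).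
  { apply inK_compact; auto; lra. }
  { apply (seq_cont_ext n _ rho); [intros x t [_ H]; replace t with 0 by lra; reflexivity|].
    apply (seq_cont_sub n A); [|now apply cont_on_K_seq]. intros x t [H1 H2]. split; auto; lra. }
  { apply seq_cont_plus; [|apply seq_cont_const]. apply Hphic. intros x t H; apply H. }
  { intros x t [Hx _] Hp. apply Hr0, (df_neg _ _ _ _ _ D); [apply Hx|lra]. }
  (* Half of the initial lower bound away from the boundary; up to time [T0] the density loses at
     most [B * T0 <= rm]. *)
  set (rm := rm2 / 2).
  set (a0 := e x0 0 / 2).
  destruct (Hec x0 0 ltac:(split; auto; lra) a0) as (d & Hd & Hnear); [unfold a0; lra|].
  set (r2 := (d / 2) ^ 2). set (h := r2 / 2).
  assert (Hr2 : 0 < r2) by (apply pow_lt; lra).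
  destruct (visible_boundary n O phi P1 P2 x0 Hn HO HOb D Hx0) as (y0 & dv & Hy0 & Hdv & Hvis).
  set (c := k * eta / (60 * B ^ 3)).
  assert (HB : 1 <= B) by (unfold B, b in *; lra).
  assert (HB3' : 0 < B ^ 3) by (apply pow_lt; lra).
  assert (Hc : 0 < c) by (apply Rdiv_lt_0_compat; [apply Rmult_lt_0_compat|]; lra).
  assert (Hball : forall x t, closure n O x -> 0 <= t <= T -> t < d -> sqdist n x0 x <= r2 -> a0 <= e x t).
  { intros x t Hx Ht Htd Hq. specialize (Hnear x t ltac:(split; auto)).
    assert (Hdist : distn n x0 x < d).
    { apply dist_sqdist; auto. unfold r2 in Hq. nra. }
    rewrite Rminus_0_r, Rabs_pos_eq in Hnear by lra. specialize (Hnear Hdist Htd).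
    apply Rabs_lt_between in Hnear. unfold a0 in *; lra. }
  set (q0 := sqdist n x0 y0) in *.
  (* The first three bounds keep [T0 < T], [2 * T0 <= 1], and [e >= a0] near [x0]; the others are
     the smallness conditions on the weight, whose shifted time reaches [2 * T0]. *)
  destruct (exists_small (T / 2) (/ 2) (d / 2) (c / (16 * B)) (rm * c / (8 * k)) (eta / (4 * B ^ 2)))
    as (T1 & HT1 & HTa & HTb & HTc & HTd & HTe & HTf).
  { lra. } { lra. } { lra. } { apply Rdiv_lt_0_compat; lra. }
  { apply Rdiv_lt_0_compat; [apply Rmult_lt_0_compat; unfold rm; lra|lra]. }
  { apply Rdiv_lt_0_compat; [|apply Rmult_lt_0_compat; [|apply pow_lt]]; lra. }
  destruct (exists_small T1 (rm / B) 1 1 1 1) as (T0 & HT0 & HTg & HTh & _); try lra.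
  { apply Rdiv_lt_0_compat; unfold rm; lra. }
  assert (Hq0 : r2 < q0).
  { apply Rnot_le_lt; intros H. specialize (Hball y0 T0 (proj1 Hy0) ltac:(lra) ltac:(lra) H).
    destruct (Hbd y0 T0 Hy0 ltac:(lra)) as [E _]. unfold a0 in Hball. lra. }
  (* The cut-off lies beyond [y0], so the Gaussian profile is positive there, but within the range
     in which [Hvis] controls the boundary. *)
  set (l := q0 + dv - h).
  assert (Hl : 0 < l) by (unfold l, h; lra).
  (* The summands provide [1 <= N], [1 <= N * dv], and the dominance of the Laplacian required in
     [gaussian_sub]. *)
  set (N := 1 + / dv + (B * (2 * l + 3 * B) / k + 2 * INR n) / (4 * r2)).
  assert (Hidv : 0 < / dv) by now apply Rinv_0_lt_compat.
  assert (HBl : 0 < B * (2 * l + 3 * B)) by (apply Rmult_lt_0_compat; lra).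
  pose proof (pos_INR n) as HnR.
  assert (Hfrac : 0 < B * (2 * l + 3 * B) / k) by (apply Rdiv_lt_0_compat; lra).
  assert (Hfrac2 : 0 <= (B * (2 * l + 3 * B) / k + 2 * INR n) / (4 * r2)) by (apply Rdiv_le_0_compat; lra).
  assert (HN : 1 <= N) by (unfold N; lra).
  assert (HNbig : B * (2 * l + 3 * B) <= k * (4 * N * r2 - 2 * INR n)).
  { assert (E : (B * (2 * l + 3 * B) / k + 2 * INR n) / (4 * r2) * (4 * r2) =
                B * (2 * l + 3 * B) / k + 2 * INR n) by (field; lra).
    assert (E' : k * (B * (2 * l + 3 * B) / k) = B * (2 * l + 3 * B)) by (field; lra).
    rewrite <- E' at 1. apply Rmult_le_compat_l; [lra|].
    assert (0 <= (1 + / dv) * (4 * r2)) by (apply Rmult_le_pos; lra).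
    replace (4 * N * r2) with ((1 + / dv) * (4 * r2)
      + (B * (2 * l + 3 * B) / k + 2 * INR n) / (4 * r2) * (4 * r2)) by (unfold N; ring). lra. }
  assert (HNdv : 1 <= N * dv).
  { assert (E : / dv * dv = 1) by (field; lra). rewrite <- E.
    apply Rmult_le_compat_r; unfold N; lra. }
  assert (HrB : forall x t, O x -> 0 <= t <= T0 -> rho x 0 - B2 * t <= rho x t).
  { intros x t Hx Ht. apply (DT_lower n O T B2 rho Rt); auto. lra. }
  assert (HBT : B * T0 <= rm).
  { assert (E : rm / B * B = rm) by (field; lra). rewrite <- E, Rmult_comm.
    apply Rmult_le_compat_r; lra. }
  (* On the boundary the initial value is the limit of the zero boundary values at positive
     times. *)
  assert (HeK0 : forall x, closure n O x -> 0 <= e x 0).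
  { intros x Hx. destruct (classic (O x)) as [Ho|Ho]; [auto|].
    apply Rnot_lt_le; intros Hneg.
    destruct (Hec x 0 ltac:(split; auto; lra) (- e x 0)) as (d' & Hd' & H'); [lra|].
    set (s := Rmin d' T / 2).
    assert (Hs : 0 < s /\ s < d' /\ s < T) by (unfold s, Rmin; destruct Rle_dec; lra).
    specialize (H' x s ltac:(split; auto; lra)). rewrite dist_self, Rminus_0_r, Rabs_pos_eq in H' by lra.
    specialize (H' ltac:(lra) ltac:(lra)). apply Rabs_lt_between in H'.
    destruct (Hbd x s ltac:(split; auto) ltac:(lra)) as [E _]. lra. }
  assert (Hdens : forall x t, O x -> 0 <= t <= T0 -> phi x <= - (1 + b + b ^ 2) * t -> 0 <= rho x t).
  { apply (density_nonneg n O phi P1 P2 T T0 b rho Rt R1 u divu); auto; try lra.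
    - intros x t Hx Ht. apply Htr; auto; lra.
    - intros x t Hx Ht. specialize (HB3 x t ltac:(split; auto; lra)).
      rewrite (sumR_ext n _ (fun j => u j x t * P1 j x)) by (intros; ring). unfold b; lra.
    - intros x t Hx Ht. specialize (HB4 x t ltac:(split; auto; lra)). unfold b; lra.
    - intros x Hx. specialize (HB5 x 0 ltac:(split; auto; lra)). unfold b; lra. }
  destruct (gaussian_beats_weight a0 (2 * ((B + a0) * exp (c / T0 ^ 2))) c (N * (q0 - h)) (N * l) T0)
    as (t & Ht & Hcontra); auto.
  { unfold a0; lra. }
  { apply Rmult_lt_0_compat; [lra|]. apply Rmult_lt_0_compat; [unfold a0; lra|apply exp_pos]. }
  { split; [apply Rmult_le_pos; unfold h; lra|]. apply Rmult_lt_compat_l; unfold l; lra. }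
  assert (Hcmp : a0 * (gaussian n x0 N h y0 t - exp (- (N * l) / t))
      - 2 * ((B + a0) * exp (c / T0 ^ 2)) * theta c t t <= e y0 t).
  { apply (comparison n O phi P1 P2 T T0 x0 k B eta rm c a0 h r2 l N dv rho e et U u E1 E2);
      auto; try lra.
    - intros x s Hx Hs. apply Hheat; auto; lra.
    - intros x s Hx Hs. apply Hbd; auto; lra.
    - unfold rm; lra.
    - assert (E : c / (16 * B) * (16 * B) = c) by (field; lra).
      assert (T0 * (16 * B) <= c) by (rewrite <- E; apply Rmult_le_compat_r; lra).
      assert (T0 * T0 <= T0 * 1) by (apply Rmult_le_compat_l; lra). nra.
    - assert (E : rm * c / (8 * k) * (8 * k) = rm * c) by (field; lra).
      assert (H1 : T0 * (8 * k) <= rm * c) by (rewrite <- E; apply Rmult_le_compat_r; lra).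
      assert (T0 * T0 <= T0 * 1) by (apply Rmult_le_compat_l; lra).
      assert (0 < k * T0) by (apply Rmult_lt_0_compat; lra).
      assert (k * (T0 * T0) <= k * (T0 * 1)) by (apply Rmult_le_compat_l; lra).
      replace (k * (2 * T0) ^ 2) with (4 * (k * (T0 * T0))) by ring. lra.
    - assert (HBB : 0 < B ^ 2) by (apply pow_lt; lra).
      assert (E : eta / (4 * B ^ 2) * (4 * B ^ 2) = eta) by (field; lra).
      assert (T0 * (4 * B ^ 2) <= eta) by (rewrite <- E; apply Rmult_le_compat_r; lra). lra.
    - intros x s Hx Hs. assert (HK : A x s) by (split; auto; lra).
      specialize (HB1 x s HK). specialize (HB3 x s HK). specialize (HB6 x s HK). specialize (HB8 x s HK).
      assert (Hs' : 0 <= s <= T0) by lra. specialize (HrB x s Hx Hs').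
      assert (HBs : B2 * s <= B * s) by (apply Rmult_le_compat_r; unfold B, b in *; lra).
      assert (HBs' : B * s <= B * T0) by (apply Rmult_le_compat_l; lra).
      split; [unfold B, b in *; lra|]. split; [unfold B, b in *; lra|].
      split; [unfold B, b in *; lra|]. split; [unfold B, b in *; lra|].
      split; [|split].
      + intros Hp. specialize (Hrm x 0 ltac:(split; auto; lra) ltac:(lra)). unfold rm in *. lra.
      + specialize (Hr0 x Hx). lra.
      + intros Hp. apply Hdens; auto.
        assert ((1 + b + b ^ 2) * s <= B * s) by (apply Rmult_le_compat_r; unfold B, b in *; lra). lra.
    - intros x Hx. assert (HK : A x 0) by (split; auto; lra).
      specialize (HB7 x 0 HK). specialize (HB10 x 0 HK). apply Rabs_le_between in HB7, HB10.
      split; [unfold B, b in *; lra|]. split; [unfold B, b in *; lra|]. auto.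
    - intros x s [Hx Hs]. specialize (HB9 x s ltac:(split; auto; lra)).
      apply Rabs_le_between in HB9. unfold B, b in *; lra.
    - unfold a0; lra.
    - intros x s [Hx Hs] Hq. apply Hball; auto; lra.
    - unfold h; lra.
    - intros y Hy Hq. apply Hvis; auto. unfold l in Hq; lra.
    - apply Hy0.
    - fold q0. lra. }
  destruct (Hbd y0 t Hy0 ltac:(lra)) as [Ey _]. unfold gaussian, theta in Hcmp. fold q0 in Hcmp. lra.
Qed.

(** The diagonal entries alone contribute [4 * D i i ^ 2], and Cauchy-Schwarz bounds the squared
    trace by [n] times the sum of the [D i i ^ 2]. After multiplication by [n] the condition on
    [2 * mu + n * lam] applies. *)
Lemma dissipation_nonneg (n : nat) (mu lam : R) (D : nat -> nat -> R) :
  (1 <= n)%nat -> 0 < mu -> 0 <= 2 * mu + INR n * lam ->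
  0 <= mu / 2 * sumR n (fun i => sumR n (fun j => (D j i + D i j) ^ 2))
       + lam * sumR n (fun j => D j j) ^ 2.
Proof.
  intros Hn Hmu Hlam. assert (HnR : 1 <= INR n) by (apply (le_INR 1); lia).
  assert (H1 : sumR n (fun i => 4 * D i i ^ 2) <= sumR n (fun i => sumR n (fun j => (D j i + D i j) ^ 2))).
  { apply sumR_le. intros i Hi. replace (4 * D i i ^ 2) with ((D i i + D i i) ^ 2) by ring.
    apply (sumR_term_le n (fun j => (D j i + D i j) ^ 2)); auto. intros; apply pow2_ge_0. }
  rewrite sumR_scal in H1. pose proof (sumR_sqr_le n (fun i => D i i)) as H2.
  set (q := sumR n (fun i => D i i ^ 2)) in *. set (s := sumR n (fun j => D j j)) in *.
  assert (H3 : mu / 2 * (4 * q) <= mu / 2 * sumR n (fun i => sumR n (fun j => (D j i + D i j) ^ 2)))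
    by (apply Rmult_le_compat_l; lra).
  assert (H4 : 0 <= INR n * (2 * mu * q + lam * s ^ 2)).
  { assert (2 * mu * s ^ 2 <= 2 * mu * (INR n * q)) by (apply Rmult_le_compat_l; lra).
    assert (0 <= (2 * mu + INR n * lam) * s ^ 2) by (apply Rmult_le_pos; [lra|apply pow2_ge_0]). nra. }
  assert (0 <= 2 * mu * q + lam * s ^ 2); [|lra].
  apply Rmult_le_reg_l with (INR n); lra.
Qed.

Theorem theorem4p1 (n : nat) (O : pt -> Prop) (mu lam kappa gam Rg : R)
  (rho0 : pt -> R) (u0 : nat -> pt -> R) (e0 : pt -> R) :
  (1 <= n)%nat ->
  is_open n O -> is_bounded n O -> smooth_boundary n O ->
  0 < mu -> 0 <= 2 * mu + INR n * lam -> 0 < kappa -> 1 < gam -> 0 < Rg ->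
  cont_on_closure n O rho0 ->
  (forall x, O x -> 0 < rho0 x) ->
  (forall x, boundary n O x -> rho0 x = 0) ->
  (forall j, (j < n)%nat -> cont_on_closure n O (u0 j)) ->
  cont_on_closure n O e0 ->
  (forall x, O x -> 0 <= e0 x) ->
  (exists x, O x /\ e0 x <> 0) ->
  forall T, 0 < T ->
  ~ exists (rho : pt -> R -> R) (u : nat -> pt -> R -> R) (e : pt -> R -> R),
      is_solution n O T mu lam kappa gam Rg rho0 u0 e0 rho u e.
Proof.
  intros Hn HO HOb Hsm Hmu Hlam Hkap Hgam HRg _ Hrho0 _ _ _ He0 (x0 & Hx0 & He00) T HT
    (rho & u & e & Hsol).
  destruct Hsol as (Crho & Cu & Ce & Hinit & Rt & M & Mt & Q & Px & U1 & U2 & V & Et & W & E1 & E2 &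
    HRt & HM & _ & _ & _ & HU & _ & HEt & HW & HE & Heqs & Hbd).
  destruct Crho as (Crho & _ & R1 & HR1). destruct Ce as (Ce & (et & Het) & _).
  destruct (smooth_boundary_defining n O Hsm) as (phi & P1 & P2 & D).
  set (divu := fun x t => sumR n (fun j => U1 j j x t)) in *.
  set (k := kappa * (gam - 1) / Rg) in *.
  (* The derivatives of the products are independent witnesses in [is_solution]; uniqueness of
     derivatives identifies them with the product rule. *)
  assert (HM' : forall j x t, (j < n)%nat -> O x -> 0 < t < T ->
            M j x t = R1 j x t * u j x t + rho x t * U1 j j x t).
  { intros j x t Hj Hx Ht.
    apply (uniqueness_limite (fun s => rho (upd x j s) t * u j (upd x j s) t) (x j)).
    - now apply (HM j Hj).
    - pose proof (derivable_pt_lim_mult (fun s => rho (upd x j s) t) (fun s => u j (upd x j s) t)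
        (x j) (R1 j x t) (U1 j j x t)) as E. cbv beta in E. rewrite upd_id in E.
      apply E; [now apply (HR1 j Hj)|now apply (HU j j Hj Hj)]. }
  assert (HW' : forall j x t, (j < n)%nat -> O x -> 0 < t < T ->
            W j x t = M j x t * e x t + rho x t * (u j x t * E1 j x t)).
  { intros j x t Hj Hx Ht.
    apply (uniqueness_limite (fun s => rho (upd x j s) t * e (upd x j s) t * u j (upd x j s) t) (x j)).
    - now apply (HW j Hj).
    - pose proof (derivable_pt_lim_mult (fun s => rho (upd x j s) t * u j (upd x j s) t)
        (fun s => e (upd x j s) t) (x j) (M j x t) (E1 j x t)) as E.
      cbv beta in E. rewrite upd_id in E.
      replace (M j x t * e x t + rho x t * (u j x t * E1 j x t))
        with (M j x t * e x t + rho x t * u j x t * E1 j x t) by ring.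
      replace (fun s => rho (upd x j s) t * e (upd x j s) t * u j (upd x j s) t)
        with (mult_fct (fun s => rho (upd x j s) t * u j (upd x j s) t) (fun s => e (upd x j s) t)).
      + apply E; [now apply (HM j Hj)|now apply (HE j Hj)].
      + apply functional_extensionality; intros s. unfold mult_fct. ring. }
  assert (HEt' : forall x t, O x -> 0 < t < T -> Et x t = Rt x t * e x t + rho x t * et x t).
  { intros x t Hx Ht. apply (uniqueness_limite (fun s => rho x s * e x s) t).
    - now apply HEt.
    - apply (derivable_pt_lim_mult (fun s => rho x s) (fun s => e x s)); [now apply HRt|now apply Het]. }
  assert (Hdc : seq_cont n (inK n O T) divu).
  { apply (seq_cont_sum n n (inK n O T) (fun j => U1 j j)). intros j Hj.
    apply cont_on_K_seq. apply (HU j j Hj Hj). }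
  apply (no_supersolution n O phi P1 P2 T k rho Rt divu (fun x t => (gam - 1) * divu x t) e et R1 u E1 E2);
    auto.
  - apply Rdiv_lt_0_compat; [apply Rmult_lt_0_compat|]; lra.
  - intros j Hj. now apply HR1.
  - intros j Hj. now apply Cu.
  - apply seq_cont_mult; auto using seq_cont_const.
  - intros x t Hx Ht. destruct (Heqs x t Hx ltac:(lra)) as (Hmass & _).
    rewrite (sumR_ext n _ _ (fun j Hj => HM' j x t Hj Hx Ht)), sumR_plus, sumR_scal in Hmass.
    unfold divu. lra.
  - intros x t Hx Ht. destruct (Heqs x t Hx ltac:(lra)) as (Hmass & _ & Hen).
    rewrite HEt', (sumR_ext n _ _ (fun j Hj => HW' j x t Hj Hx Ht)), sumR_plus, sumR_scal in Hen by auto.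
    rewrite (sumR_ext n (fun j => M j x t * e x t) (fun j => e x t * M j x t)), sumR_scal in Hen
      by (intros; ring).
    pose proof (dissipation_nonneg n mu lam (fun i j => U1 i j x t) Hn Hmu Hlam) as Hdiss.
    (* Passing from the conservative to the transport form of the energy equation: [e] times the
       mass equation drops out. *)
    assert (E : e x t * (Rt x t + sumR n (fun j => M j x t)) = 0) by (rewrite Hmass; ring).
    cbv beta in Hen, Hdiss. unfold divu. lra.
  - intros x Hx. destruct (Hinit x Hx) as (-> & _). auto.
  - intros x Hx. destruct (Hinit x Hx) as (_ & _ & ->). auto.
  - exists x0. split; auto. destruct (Hinit x0 Hx0) as (_ & _ & ->). specialize (He0 x0 Hx0). lra.
Qed.
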